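(* Let $X$ be an $n\times n$ real symmetric random matrix with $X_{ij}=b_{ij}g_{ij}$, where $b_{ij}=b_{ji}\ge 0$ are given scalars, $g_{ij}=g_{ji}$, and $(g_{ij})_{i\ge j}$ are i.i.d. standard Gaussian random variables. Then for every $p\in\mathbb{N}$ $$(\mathbf{E}[\mathrm{Tr}[X^{2p}]])^{1/2p} \le 2\Bigg(\sum_i\Bigg(\sum_j b_{ij}^2\Bigg)^p\Bigg)^{1/2p} + 5\sqrt{2p}\,\Bigg(\sum_i \max_j b_{ij}^{2p}\Bigg)^{1/2p}.$$
   Context: $\mathbb N=\{1,2,\dots\}$; all indices range over $\{1,\dots,n\}$. *)

(* Defs.v *)
From mathcomp Require Import all_boot all_order all_algebra finmap.
From mathcomp Require Import all_classical all_reals all_analysis.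

Set Implicit Arguments.
Unset Strict Implicit.
Unset Printing Implicit Defensive.

Import Order.TTheory GRing.Theory Num.Theory.
Import numFieldNormedType.Exports.

Local Open Scope classical_set_scope.
Local Open Scope ring_scope.
Local Open Scope ereal_scope.

(* [X] has law N(0,1). The two measures are compared on measurable sets only:
   equality as functions on all of [set R] would be strictly stronger, since
   the values of a measure on non-measurable sets are arbitrary. *)
Definition standard_gaussian (d : measure_display) (T : measurableType d)
    (R : realType) (P : probability T R) (X : {RV P >-> R}) : Prop :=
  forall A : set R, measurable A ->
    distribution P X A = normal_prob (0 : R)%R (1 : R)%R A.

(* Mutual (not merely pairwise) independence of the subfamily [(X i)_(i in D)]. *)
Definition mutually_independent (d d' : measure_display)
    (T : measurableType d) (T' : measurableType d') (R : realType)
    (P : probability T R) (I : choiceType) (D : set I)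
    (X : I -> {RV P >-> T'}) : Prop :=
  forall (J : {fset I}) (A : I -> set T'), [set` J] `<=` D ->
    (forall i, measurable (A i)) ->
    P (\bigcap_(i in [set` J]) (X i @^-1` A i)) =
    \prod_(i <- J) P (X i @^-1` A i).

(* Main.v *)
(** Write A and B for the two p-norms on the right-hand side, sigma_i^2 for the
    row sums of b_ij^2, and s_i for the row maxima of b_ij.  By the Wick formula
    E[Tr X^2p] is a sum over closed walks u of the products of the weights
    b_{u_t u_t+1} times a nonnegative coefficient which is invariant under
    rotation of u.

    With lam_i = max(sigma_i / A, s_i / B) and b'_ij = b_ij / max(lam_i, lam_j),
    the arithmetic-geometric inequality along a walk and rotation invariance
    bound this sum by 2 sum_i lam_i^2p Z_i, where Z_i is the sum over the closed
    walks based at i with weights b'.  Now the row sums of b'^2 are at most A^2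
    and the entries of b' are at most B, uniformly.

    On the bosonic Fock space with one mode per edge, Z_i is a vacuum matrix
    element of the 2p-th power of (creation + annihilation); a Schur test on the
    states with at most 2p particles bounds the norm of this operator by
    K = 2 A + 4 sqrt(2p) B, while one application of it to the vacuum has norm
    at most A.  Hence Z_i <= A^2 K^(2p-2).  As sum_i lam_i^2p <= 2, altogether
    E[Tr X^2p] <= 4 A^2 K^(2p-2) <= K^2p. *)
Require Import Defs.
From HB Require Import structures.
From mathcomp Require Import all_boot all_order all_algebra finmap.
From mathcomp Require Import all_classical all_reals all_analysis.
From mathcomp Require Import measurable_realfun ring lra zify.

Set Implicit Arguments.
Unset Strict Implicit.
Unset Printing Implicit Defensive.

Import Order.TTheory GRing.Theory Num.Theory.
Import numFieldNormedType.Exports.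

Local Open Scope ring_scope.

(** * Hermite polynomials and Wick products *)

Section Hermite.
Variable R : rcfType.
Local Notation sqrtn n := (Num.sqrt (n%:R : R)).

(* Normalized so that the operator of multiplication by X is symmetric. *)
Fixpoint hermite (n : nat) : {poly R} :=
  if n is m.+1 then
    (sqrtn m.+1)^-1 *:
      ('X * hermite m - (if m is k.+1 then sqrtn m *: hermite k else 0))
  else 1.
Arguments hermite : simpl never.

Lemma sqrtn_neq0 (n : nat) : sqrtn n.+1 != 0.
Proof. by rewrite gt_eqF// sqrtr_gt0 ltr0Sn. Qed.

Lemma sqr_sqrtn (n : nat) : sqrtn n * sqrtn n = n%:R.
Proof. by rewrite -expr2 sqr_sqrtr. Qed.

Lemma hermiteSE (n : nat) : hermite n.+1 =
  (sqrtn n.+1)^-1 *: ('X * hermite n - sqrtn n *: hermite n.-1).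
Proof. by case: n => [|n]//; rewrite /hermite sqrtr0 scale0r. Qed.

Lemma mulX_hermite (n : nat) :
  'X * hermite n = sqrtn n.+1 *: hermite n.+1 + sqrtn n *: hermite n.-1.
Proof. by rewrite hermiteSE scalerA divff ?sqrtn_neq0// scale1r subrK. Qed.

(** Strong induction: after differentiating the recurrence, [X h_n - sqrt(n) h_(n-1)] reassembles to
    a multiple of [h_(n+1)]. *)
Lemma deriv_hermite (n : nat) : (hermite n)^`() = sqrtn n *: hermite n.-1.
Proof.
elim/ltn_ind: n => -[|n] IH; first by rewrite derivC sqrtr0 scale0r.
have hn := IH n (leqnn _).
rewrite hermiteSE derivZ derivB derivM derivX mul1r hn derivZ -scalerAr.
case: n IH hn => [|n] IH hn.
  by rewrite sqrtr0 !scale0r addr0 subr0 sqrtr1 invr1 !scale1r.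
rewrite (IH n (ltnW _))//= -addrA -scalerBr [X in _ *: (X - _)]mulX_hermite addrK.
rewrite (scalerA (sqrtn n.+1)) sqr_sqrtn -[X in X + _]scale1r -scalerDl scalerA.
by rewrite nat1r -[X in _ * X]sqr_sqrtn mulKf// sqrtn_neq0.
Qed.

(** Integration by parts turns the first term of the recurrence into [sqrtn n] times
    [mu (hermite n.-1)], which the second term cancels. *)
Lemma stein_hermite (mu : {scalar {poly R}}) :
  mu 1 = 1 -> (forall q : {poly R}, mu ('X * q) = mu q^`()) ->
  forall n, mu (hermite n) = (n == 0)%:R.
Proof.
move=> mu1 stein [|n]; first by rewrite mu1.
rewrite hermiteSE linearZ/= linearB/= stein deriv_hermite.
by rewrite subrr mulr0.
Qed.

End Hermite.

Section Wick.
Variables (R : rcfType) (E : finType) (mu : {scalar {poly R}}).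
Hypothesis mu_hermite : forall n, mu (hermite R n) = (n == 0)%:R.
Local Notation sqrtn n := (Num.sqrt (n%:R : R)).

Definition incr (m : E -> nat) (e : E) : E -> nat := fun f => (m f + (f == e))%N.
(** Truncated at an empty edge, where its coefficient [sqrtn (m e)] in [wick_cons] vanishes. *)
Definition decr (m : E -> nat) (e : E) : E -> nat := fun f => (m f - (f == e))%N.

(* When [mu] is integration against N(0,1), this is the expectation of the
   product of the Gaussians listed in [l] with the Hermite polynomials of
   degrees [m]; expanding it along [l] yields the creation and annihilation
   operators. *)
Definition wick (l : seq E) (m : E -> nat) : R :=
  \prod_e mu ('X^(count_mem e l) * hermite R (m e)).

Lemma eq_wick l m m' : m =1 m' -> wick l m = wick l m'.
Proof. by move=> mm'; apply: eq_bigr => e _; rewrite mm'. Qed.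

Lemma perm_wick l l' m : perm_eq l l' -> wick l m = wick l' m.
Proof. by move=> /permP ll'; apply: eq_bigr => e _; rewrite ll'. Qed.

Lemma wick_nil m : wick [::] m = [forall e, m e == 0]%:R.
Proof.
rewrite /wick; under eq_bigr do rewrite /= mul1r mu_hermite.
case: forallP => [m0|/forallP].
  by rewrite big1// => e _; rewrite m0.
by rewrite negb_forall => /existsP[e me]; rewrite (bigD1 e)//= (negPf me) mul0r.
Qed.

(** Only the factor at [e] changes; the three-term recurrence splits it into creation and
    annihilation. *)
Lemma wick_cons e l m :
  wick (e :: l) m = sqrtn (m e).+1 * wick l (incr m e) + sqrtn (m e) * wick l (decr m e).
Proof.
rewrite /wick (bigD1 e)// [X in _ = _ * X + _](bigD1 e)//.
rewrite [X in _ = _ + _ * X](bigD1 e)//= /incr /decr !eqxx addn1 subn1 add1n.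
have rest (m' : E -> nat) : (forall f, f != e -> m' f = m f) ->
    \prod_(i | i != e) mu ('X^((e == i) + count_mem i l) * hermite R (m i)) =
    \prod_(i | i != e) mu ('X^(count_mem i l) * hermite R (m' i)).
  by move=> mm'; apply: eq_bigr => i ie; rewrite mm'// eq_sym (negPf ie).
rewrite (rest (fun f => m f + (f == e))%N) => [|f /negPf->]; last by rewrite addn0.
rewrite -[in X in _ + X]rest => [|f /negPf->]; last by rewrite subn0.
rewrite -(rest (fun f => m f + (f == e))%N) => [|f /negPf->]; last by rewrite addn0.
rewrite !mulrA -mulrDl exprSr -mulrA mulX_hermite mulrDr -!scalerAr linearD/=.
by rewrite !linearZ.
Qed.

(** The expansion has nonnegative coefficients. This makes walk weights monotone in nonnegative
    entries of [b]. *)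
Lemma wick_ge0 l m : 0 <= wick l m.
Proof.
elim: l m => [|e l IH] m; first by rewrite wick_nil.
by rewrite wick_cons addr_ge0// mulr_ge0 ?sqrtr_ge0.
Qed.

End Wick.

(** * The norm of the hopping operator on Fock space *)

(** Termwise [2 c x y <= u x^2 + v y^2]; then the row sums of [u] and the column sums of [v] are
    bounded by [K]. *)
Lemma schur_test (R : realFieldType) (S T : finType) (c u v : S -> T -> R)
    (K : R) (x : S -> R) (y : T -> R) :
  (forall a b, 0 <= u a b) -> (forall a b, 0 <= v a b) ->
  (forall a b, c a b ^+ 2 <= u a b * v a b) ->
  (forall a, \sum_b u a b <= K) -> (forall b, \sum_a v a b <= K) ->
  2 * \sum_a \sum_b c a b * x a * y b <=
  K * (\sum_a x a ^+ 2 + \sum_b y b ^+ 2).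
Proof.
move=> u0 v0 cuv uK vK.
have amgm a b : 2 * (c a b * x a * y b) <= u a b * x a ^+ 2 + v a b * y b ^+ 2.
  have [ua0|ua_neq0] := eqVneq (u a b) 0.
    have /eqP : c a b ^+ 2 == 0.
      by rewrite eq_le sqr_ge0 andbT (le_trans (cuv a b))// ua0 mul0r.
    move/eqP; rewrite sqrf_eq0 => /eqP ->.
    by rewrite !mul0r mulr0 addr_ge0// mulr_ge0 ?sqr_ge0.
  have ua_gt0 : 0 < u a b by rewrite lt_def ua_neq0 u0.
  rewrite -(ler_pM2l ua_gt0) -subr_ge0.
  have cuvy : c a b ^+ 2 * y b ^+ 2 <= u a b * v a b * y b ^+ 2.
    by rewrite ler_wpM2r ?sqr_ge0.
  (* After multiplication by [u a b], this square and [c^2 <= u v] give the inequality. *)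
  have := sqr_ge0 (u a b * x a - c a b * y b); nra.
rewrite mulr_sumr; under eq_bigr do rewrite mulr_sumr.
apply: (@le_trans _ _ (\sum_a \sum_b (u a b * x a ^+ 2 + v a b * y b ^+ 2))).
  by apply: ler_sum => a _; apply: ler_sum => b _; exact: amgm.
under eq_bigr do rewrite big_split/= -mulr_suml.
rewrite big_split/= [X in _ + X]exchange_big/=.
under [X in _ + X]eq_bigr do rewrite -mulr_suml.
rewrite mulrDr !mulr_sumr lerD// ler_sum// => a _; rewrite ler_wpM2r ?sqr_ge0//.
Qed.

Lemma sum_pred1 (T : finType) (x : T) : (\sum_y (y == x) = 1)%N.
Proof. by rewrite (bigD1 x)//= eqxx big1// => y /negPf->. Qed.

Section Fock.
Variables (R : rcfType) (I E : finType) (ed : I -> I -> E) (L : nat).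
Hypothesis ed_sym : forall i j, ed i j = ed j i.
Hypothesis ed_inj : forall i j k l, ed i j = ed k l ->
  (i = k /\ j = l) \/ (i = l /\ j = k).

Local Notation occ := {ffun E -> 'I_L.+1}.
Implicit Types (m : occ) (i j k l : I).

(* A state [(i, m)] is a position [i] together with the number of particles
   sitting on each edge; [ed i j] is the edge joining [i] and [j]. *)
Definition total m : nat := (\sum_e m e)%N.
Definition deg m i : nat := (\sum_j m (ed i j))%N.
Definition up e m m' := [forall f, m' f == (m f + (f == e))%N :> nat].

Lemma upP e m m' : reflect (forall f, m' f = (m f + (f == e))%N :> nat) (up e m m').
Proof. exact: 'forall_eqP. Qed.

Lemma up_injr e m m1 m2 : up e m m1 -> up e m m2 -> m1 = m2.
Proof.
move=> /upP h1 /upP h2; apply/ffunP => f; apply/val_inj.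
by rewrite /= h1 h2.
Qed.

Lemma up_injl e m m1 m2 : up e m1 m -> up e m2 m -> m1 = m2.
Proof.
move=> /upP h1 /upP h2; apply/ffunP => f; apply/val_inj/eqP.
by rewrite /= -(eqn_add2r (f == e)) -h1 -h2.
Qed.

(** Adding or removing a particle on a given edge leads to at most one occupation, so the sums over
    occupations below have at most one term. *)
Lemma sum_uniq_le (Q : pred occ) (F : occ -> R) c : 0 <= c ->
  (forall m m', Q m -> Q m' -> m = m') -> (forall m, Q m -> F m <= c) ->
  \sum_(m | Q m) F m <= c.
Proof.
move=> c0 Quniq QF; have [m Qm|Q0] := pickP Q; last by rewrite big_pred0.
rewrite (big_pred1 m) ?QF// => m' /=.
by apply/idP/eqP => [Qm'|->//]; exact: Quniq.
Qed.

Lemma ed_injr l j k : (ed l k == ed j l) = (k == j).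
Proof.
apply/eqP/eqP => [|->]; last by rewrite ed_sym.
by move=> /ed_inj[[-> ->]//|[_ ->]].
Qed.

Lemma deg_up j l m m' : up (ed j l) m m' -> deg m' l = (deg m l).+1.
Proof.
move=> /upP mm'; rewrite /deg; under eq_bigr do rewrite mm' ed_injr.
by rewrite big_split/= sum_pred1 addn1.
Qed.

Lemma total_up e m m' : up e m m' -> total m' = (total m).+1.
Proof.
move=> /upP mm'; rewrite /total; under eq_bigr do rewrite mm'.
by rewrite big_split/= sum_pred1 addn1.
Qed.

(** Handshake: an edge is [ed i j] for at most two ordered pairs. *)
Lemma sum_deg m : (\sum_i deg m i <= 2 * total m)%N.
Proof.
rewrite /deg pair_bigA/= (partition_big (fun p => ed p.1 p.2) predT)//=.
rewrite /total big_distrr/= leq_sum// => e _.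
rewrite (eq_bigr (fun=> m e : nat)) => [|p /eqP->//].
rewrite sum_nat_const leq_mul2r; apply/orP; right.
have [[i j] /eqP <-|/eq_card0->//] := pickP [pred p : I * I | ed p.1 p.2 == e].
rewrite (@leq_trans #|[set (i, j); (j, i)]|)//; last by rewrite cards2; case: eqP.
apply/subset_leq_card/fintype.subsetP => -[k l]; rewrite !inE/= => /eqP/ed_inj/=.
by move=> [[-> ->]|[-> ->]]; rewrite eqxx ?orbT.
Qed.

Variables (b : I -> I -> R) (A B : R).
Hypotheses (A_gt0 : 0 < A) (B_gt0 : 0 < B) (L_gt0 : (0 < L)%N).
Hypothesis b_ge0 : forall i j, 0 <= b i j.
Hypothesis b_sym : forall i j, b i j = b j i.
Hypothesis b_row : forall i, \sum_j b i j ^+ 2 <= A ^+ 2.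
Hypothesis b_leB : forall i j, b i j <= B.

Local Notation state := (I * occ)%type.
Local Notation s := (Num.sqrt (L%:R : R)).
Implicit Types x y : state.

(** The cutoff at [L] particles keeps Fock space finite; walks of at most [L] steps from the vacuum
    do not notice it. *)
Definition creates x y := up (ed x.1 y.1) x.2 y.2 && (total y.2 <= L)%N.

Definition creation x y : R :=
  if creates x y then b x.1 y.1 * Num.sqrt (y.2 (ed x.1 y.1))%:R else 0.

(* The two weights of the Schur test.  A jump to a vertex not touched by any
   particle can be undone in only one way; a jump to a touched vertex is charged
   to the degrees, which sum to at most 2L. *)
Definition weight_out x y : R :=
  if creates x y then
    if deg x.2 y.1 == 0%N then b x.1 y.1 ^+ 2 / A
    else B * (deg y.2 y.1)%:R / (2 * s)
  else 0.

Definition weight_in x y : R :=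
  if creates x y then
    if deg x.2 y.1 == 0%N then A
    else 2 * B * s * (y.2 (ed x.1 y.1))%:R / (deg y.2 y.1)%:R
  else 0.

Let s_gt0 : 0 < s. Proof. by rewrite sqrtr_gt0 ltr0n. Qed.
Let s_sqr : s ^+ 2 = L%:R. Proof. by rewrite sqr_sqrtr. Qed.

Lemma weight_out_ge0 x y : 0 <= weight_out x y.
Proof.
have s0 := s_gt0; rewrite /weight_out; case: ifP => // _; case: ifP => _.
  by rewrite divr_ge0 ?sqr_ge0// ltW.
by rewrite divr_ge0 ?mulr_ge0 ?ler0n// ltW.
Qed.

Lemma weight_in_ge0 x y : 0 <= weight_in x y.
Proof.
have s0 := s_gt0; rewrite /weight_in; case: ifP => // _; case: ifP => _.
  exact: ltW.
by rewrite divr_ge0 ?mulr_ge0 ?ler0n// ltW.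
Qed.

Lemma creation_weights x y : creation x y ^+ 2 <= weight_out x y * weight_in x y.
Proof.
have s0 := s_gt0; rewrite /creation /weight_out /weight_in.
case: x y => [j m] [l m']; rewrite /creates/=.
case: ifP => [/andP[mm' _]|_]; last by rewrite expr0n mul0r.
have dm' := deg_up mm'; rewrite exprMn sqr_sqrtr ?ler0n//.
case: ifPn => [/eqP d0|_].
  (* A jump to an untouched vertex leaves degree 1 there, so the edge used carries at most one
     particle. *)
  rewrite divfK ?gt_eqF// ler_piMr ?sqr_ge0// lern1.
  rewrite -ltnS (leq_ltn_trans _ (_ : deg m' l < 2)%N)//; last by rewrite dm' d0.
  by rewrite /deg (bigD1 j)//= [ed l j]ed_sym leq_addr.
have -> : B * (deg m' l)%:R / (2 * s) *
    (2 * B * s * (m' (ed j l))%:R / (deg m' l)%:R) = B ^+ 2 * (m' (ed j l))%:R.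
  by rewrite dm'; field; rewrite nat1r pnatr_eq0 (gt_eqF s0).
by rewrite ler_wpM2r ?ler0n// lerXn2r ?nnegrE// ltW.
Qed.

Lemma sum_state (F : state -> R) : \sum_x F x = \sum_l \sum_m F (l, m).
Proof. by rewrite pair_bigA; apply: eq_bigr => -[]. Qed.

(** Untouched targets contribute at most [A^2 / A]. At touched ones the degree at most doubles,
    giving [B * deg / s], and the degrees sum to at most [2 * s^2]. *)
Lemma sum_weight_out x : \sum_y weight_out x y <= A + 2 * B * s.
Proof.
have s0 := s_gt0; case: x => j m; rewrite sum_state /weight_out /creates/=.
have K0 : 0 <= A + 2 * B * s by rewrite addr_ge0 ?mulr_ge0// ltW.
have [mL|Lm] := leqP L (total m).
  rewrite big1// => l _; rewrite big1// => m' _; case: ifP => // /andP[/total_up ->].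
  by rewrite ltnNge mL.
apply: (@le_trans _ _ (\sum_l (b j l ^+ 2 / A + B * (deg m l)%:R / s))).
  apply: ler_sum => l _; rewrite -big_mkcond/=; apply: sum_uniq_le => [||m'].
  - by rewrite addr_ge0// divr_ge0 ?sqr_ge0 ?mulr_ge0 ?ler0n// ltW.
  - by move=> m1 m2 /andP[h1 _] /andP[h2 _]; exact: up_injr h1 h2.
  - move=> /andP[/deg_up -> _]; case: eqP => [->|/eqP d0].
      by rewrite mulr0 mul0r addr0.
    rewrite ler_wpDl ?divr_ge0 ?sqr_ge0 ?(ltW A_gt0)//.
    have -> : B * (deg m l)%:R / s = B * ((deg m l)%:R *+ 2) / (2 * s).
      by field; rewrite gt_eqF.
    rewrite ler_pM2r ?invr_gt0 ?mulr_gt0// ler_pM2l// -mulrnA ler_nat.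
    by rewrite muln2 -addnn -addn1 leq_add2l lt0n.
rewrite big_split/= -mulr_suml lerD//.
  by rewrite ler_pdivrMr// -expr2 b_row.
rewrite -mulr_suml -mulr_sumr -natr_sum ler_pdivrMr// -!mulrA -expr2 s_sqr.
rewrite mulrCA ler_pM2l// -natrM ler_nat (leq_trans (sum_deg m))//.
by rewrite leq_mul2l ltnW.
Qed.

(** Undoing a jump into [j] removes a particle from an edge at [j]. The charges are proportional to
    the occupations of these edges and sum to [2 * B * s]; the weight [A] occurs only if [j] has
    degree 1, and then for a single source. *)
Lemma sum_weight_in y : \sum_x weight_in x y <= A + 2 * B * s.
Proof.
have s0 := s_gt0; have A0 := ltW A_gt0; have B0 := ltW B_gt0; have s1 := ltW s0.
case: y => j m; rewrite sum_state /weight_in /creates/=.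
have [d0|d_gt0] := posnP (deg m j).
  rewrite big1 ?addr_ge0 ?mulr_ge0// ?ltW// => l _; rewrite big1// => m' _.
  by case: ifP => // /andP[/deg_up]; rewrite d0.
pose d1 : R := (deg m j == 1%N)%:R.
apply: (@le_trans _ _ (\sum_l (d1 * A * (m (ed j l))%:R +
    2 * B * s / (deg m j)%:R * (m (ed j l))%:R))).
  apply: ler_sum => l _; rewrite -big_mkcond/=; apply: sum_uniq_le => [||m'].
  - by rewrite addr_ge0// !mulr_ge0 ?invr_ge0 ?ler0n// ltW.
  - by move=> m1 m2 /andP[h1 _] /andP[h2 _]; exact: up_injl h1 h2.
  - move=> /andP[mm' _]; rewrite [ed l j]ed_sym; case: eqP => [d0|_].
      rewrite ler_wpDr ?mulr_ge0 ?invr_ge0 ?ler0n//.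
      rewrite /d1 (deg_up mm') d0 eqxx mul1r ler_pMr// ler1n.
      by move/upP: mm' => ->; rewrite [ed l j]ed_sym eqxx addn1.
    rewrite ler_wpDl ?mulr_ge0 ?ler0n//.
    by rewrite mulrAC.
rewrite big_split/= -!mulr_sumr -natr_sum -/(deg m j) divfK; last first.
  by rewrite pnatr_eq0 -lt0n.
rewrite lerD2r /d1; case: eqP => [->|_]; first by rewrite mul1r mulr1.
by rewrite !mul0r ltW.
Qed.

Definition hop x y : R := creation x y + creation y x.

Definition hop_op (f : state -> R) x : R := \sum_y hop x y * f y.

Lemma hop_adj (f g : state -> R) :
  \sum_x f x * hop_op g x = \sum_x hop_op f x * g x.
Proof.
rewrite /hop_op; under eq_bigr do rewrite mulr_sumr.
rewrite exchange_big/=; apply: eq_bigr => y _; rewrite mulr_suml.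
by apply: eq_bigr => x _; rewrite /hop addrC mulrCA mulrA.
Qed.

(** Schur test for the creation part and, with [f] and [g] exchanged, for its adjoint. *)
Lemma hop_form (f g : state -> R) : \sum_x f x * hop_op g x <=
  (A + 2 * B * s) * (\sum_x f x ^+ 2 + \sum_x g x ^+ 2).
Proof.
have sc u v := schur_test u v weight_out_ge0 weight_in_ge0 creation_weights
  sum_weight_out sum_weight_in.
have -> : \sum_x f x * hop_op g x =
    \sum_x \sum_y creation x y * f x * g y + \sum_x \sum_y creation x y * g x * f y.
  rewrite [X in _ + X]exchange_big -big_split; apply: eq_bigr => x _ /=.
  rewrite mulr_sumr -big_split; apply: eq_bigr => y _ /=; rewrite /hop; ring.
have := sc f g; have := sc g f; nra.
Qed.

Lemma hop_norm (f : state -> R) : \sum_x hop_op f x ^+ 2 <=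
  (2 * A + 4 * B * s) ^+ 2 * \sum_x f x ^+ 2.
Proof.
have s0 := s_gt0; set K := 2 * A + 4 * B * s.
have K0 : 0 < K by rewrite addr_gt0 ?mulr_gt0.
(* The factor [K^-1] balances the two squares, so that the form bound with [K / 2] becomes the norm
   bound [K]. *)
have := hop_form (fun x => K^-1 * hop_op f x) f.
under eq_bigr do rewrite -mulrA -expr2; rewrite -mulr_sumr.
under [X in _ * (X + _)]eq_bigr do rewrite exprMn; rewrite -mulr_sumr.
set N := \sum_x hop_op f x ^+ 2; set M := \sum_x f x ^+ 2 => h.
have {h} : K ^+ 2 * 2 * (K^-1 * N) <= K ^+ 2 * (K * (K^-1 ^+ 2 * N + M)).
  rewrite -mulrA ler_pM2l ?exprn_gt0//.
  apply: le_trans (_ : 2 * ((A + 2 * B * s) * (K^-1 ^+ 2 * N + M)) <= _).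
    by rewrite ler_pM2l.
  by rewrite mulrA /K; lra.
have -> : K ^+ 2 * 2 * (K^-1 * N) = K * (N *+ 2) by field; rewrite gt_eqF.
have -> : K ^+ 2 * (K * (K^-1 ^+ 2 * N + M)) = K * (N + K ^+ 2 * M).
  by field; rewrite gt_eqF.
by rewrite ler_pM2l// mulr2n lerD2l.
Qed.

Definition vacuum : occ := [ffun=> ord0].
Definition start i : state -> R := fun x => (x == (i, vacuum))%:R.

(** From the vacuum only creation is possible, and each neighbour [j] is reached in at most one
    state, with amplitude [b i j]. *)
Lemma hop_start i : \sum_x hop_op (start i) x ^+ 2 <= A ^+ 2.
Proof.
have hopE x : hop_op (start i) x = creation (i, vacuum) x.
  rewrite /hop_op (bigD1 (i, vacuum))//= big1 => [|y /negPf yi].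
    rewrite /start eqxx mulr1 addr0 /hop /creation.
    rewrite [X in X + _](_ : _ = 0) ?add0r//; case: ifP => // /andP[/upP/=].
    by move=> /(_ (ed x.1 i)); rewrite ffunE eqxx addn1.
  by rewrite /start yi mulr0.
under eq_bigr do rewrite hopE.
rewrite sum_state; apply: le_trans (b_row i); apply: ler_sum => j _.
rewrite /creation /creates/=.
under eq_bigr => m _ do rewrite (fun_if (fun z => z ^+ 2)) expr0n/=.
rewrite -big_mkcond/=; apply: sum_uniq_le => [||m /andP[/upP]].
- exact: sqr_ge0.
- by move=> m1 m2 /andP[h1 _] /andP[h2 _]; exact: up_injr h1 h2.
- by move=> -> _; rewrite ffunE eqxx sqrtr1 mulr1.
Qed.

(** Self-adjointness turns the matrix element into the squared norm of [p] applications; the first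
    is bounded by [A], the other [p.-1] by the operator norm. *)
Lemma hop_moment i p : (0 < p)%N ->
  iter (2 * p) hop_op (start i) (i, vacuum) <=
  A ^+ 2 * (2 * A + 4 * B * s) ^+ (2 * p.-1).
Proof.
move=> p_gt0.
have adj (k : nat) (f g : state -> R) :
    \sum_x f x * iter k hop_op g x = \sum_x iter k hop_op f x * g x.
  by elim: k f g => // k IH f g; rewrite iterSr iterS IH hop_adj.
have -> : iter (2 * p) hop_op (start i) (i, vacuum) =
    \sum_x iter p hop_op (start i) x ^+ 2.
  under [RHS]eq_bigr do rewrite expr2.
  have st x : start i x = (x == (i, vacuum))%:R by [].
  rewrite -adj -iterD addnn -mul2n (bigD1 (i, vacuum))//= big1 => [|x /negPf xi].
    by rewrite st eqxx mul1r addr0.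
  by rewrite st xi mul0r.
rewrite -{1}(prednK p_gt0) iterSr.
elim: p.-1 => [|k IH]; first by rewrite mulr1 hop_start.
rewrite iterS (le_trans (hop_norm _))// mulnS exprD mulrCA.
by rewrite ler_wpM2l ?exprn_even_ge0.
Qed.

End Fock.

(** * Sums over closed walks *)

Section Walks.
Variables (R : comPzRingType) (I : finType).
Implicit Types (i j l : I) (f g : seq (I * I) -> R).

(* The walks go from [j] to [i] and are represented by the sequence of their
   steps. *)
Fixpoint walk_sum (k : nat) i j f : R :=
  if k is k'.+1 then \sum_l walk_sum k' i l (fun s => f ((j, l) :: s))
  else (j == i)%:R * f [::].

Lemma eq_walk_sum k i j f g : f =1 g -> walk_sum k i j f = walk_sum k i j g.
Proof.
elim: k j f g => [|k IH] j f g fg /=; first by rewrite fg.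
by apply: eq_bigr => l _; apply: IH => s; rewrite fg.
Qed.

Lemma walk_sumD k i j f g :
  walk_sum k i j (fun s => f s + g s) = walk_sum k i j f + walk_sum k i j g.
Proof.
elim: k j f g => [|k IH] j f g /=; first by rewrite mulrDr.
by rewrite -big_split; apply: eq_bigr => l _; rewrite IH.
Qed.

Lemma walk_sumZ k i j c f :
  walk_sum k i j (fun s => c * f s) = c * walk_sum k i j f.
Proof.
elim: k j f => [|k IH] j f /=; first by rewrite mulrCA.
by rewrite mulr_sumr; apply: eq_bigr => l _; rewrite IH.
Qed.

(** The closed walk through [s]: [rot 1] makes the last step return to the head. *)
Definition steps (s : seq I) : seq (I * I) := zip s (rot 1 s).

Lemma perm_steps_rot k (s : seq I) : perm_eq (steps (rot k s)) (steps s).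
Proof.
rewrite /steps.
have [sk|sk] := leqP (size s) k; first by rewrite rot_oversize.
rewrite rot_rot perm_sym.
rewrite -(perm_rot k) -[rot k (zip _ _)]zip_unzip /unzip1 /unzip2 !map_rot.
rewrite -/(unzip1 _) -/(unzip2 _) !unzip1_zip ?unzip2_zip ?size_rot//.
Qed.

Lemma sum_tuple_cons k (f : k.+1.-tuple I -> R) :
  \sum_s f s = \sum_i \sum_(t : k.-tuple I) f [tuple of i :: t].
Proof.
rewrite pair_bigA (reindex (fun p : I * k.-tuple I => [tuple of p.1 :: p.2]))//=.
exists (fun s => (thead s, behead_tuple s)) => [[i t] _|s _] /=.
  by rewrite theadE; congr pair; apply: val_inj.
by rewrite [RHS]tuple_eta.
Qed.

Lemma sum_open_walks k i j f :
  \sum_(t : k.-tuple I) f (zip (j :: t) (rcons t i)) = walk_sum k.+1 i j f.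
Proof.
elim: k j f => [|k IH] j f.
  rewrite [RHS]/= [RHS](bigD1 i)//= eqxx mul1r [X in _ + X]big1 => [|l /negPf->].
    rewrite addr0.
    by rewrite (big_pred1 [tuple])//= => t; apply/esym/eqP; exact: tuple0.
  by rewrite mul0r.
rewrite sum_tuple_cons [RHS]/=; apply: eq_bigr => l _.
by rewrite -[RHS](IH l (fun s => f ((j, l) :: s))).
Qed.

(** Links cyclic vertex sequences, on which rotation acts, with walks based at their head. *)
Lemma sum_closed_walks k f (c : I -> R) :
  \sum_(s : k.+1.-tuple I) c (thead s) * f (steps s) =
  \sum_i c i * walk_sum k.+1 i i f.
Proof.
rewrite sum_tuple_cons; apply: eq_bigr => i _.
rewrite -sum_open_walks mulr_sumr; apply: eq_bigr => t _.
by rewrite theadE /steps/= rot1_cons.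
Qed.

End Walks.

Lemma exprmx_walk_sum (R : comPzRingType) (n k : nat) (M : 'M[R]_n) (i j : 'I_n) :
  (M ^+ k) j i = walk_sum k i j (fun s => \prod_(x <- s) M x.1 x.2).
Proof.
elim: k j => [|k IH] j /=; first by rewrite big_nil mulr1 expr0 mxE.
rewrite exprS mxE; apply: eq_bigr => l _; rewrite IH -walk_sumZ.
by apply: eq_walk_sum => s; rewrite big_cons.
Qed.

(** * Walk sums as matrix elements of the hopping operator *)

Section FockWalks.
Variables (R : rcfType) (I E : finType) (ed : I -> I -> E) (L : nat).
Variables (mu : {scalar {poly R}}) (b : I -> I -> R).
Hypothesis mu_hermite : forall n, mu (hermite R n) = (n == 0)%:R.
Hypothesis b_sym : forall i j, b i j = b j i.
Hypothesis ed_sym : forall i j, ed i j = ed j i.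
Local Notation occ := {ffun E -> 'I_L.+1}.
Local Notation sqrtn n := (Num.sqrt (n%:R : R)).
Local Notation occn m := (fun e => nat_of_ord (m e)).

(** With Gaussian [mu], [ed := edge] and [m = 0], this is the expectation of the product of the
    matrix entries along [s]. *)
Definition walk_weight (s : seq (I * I)) (m : E -> nat) : R :=
  \prod_(x <- s) b x.1 x.2 * wick mu [seq ed x.1 x.2 | x <- s] m.

Lemma occ_le_total (m : occ) e : (m e <= total m)%N.
Proof. by rewrite /total (bigD1 e)//= leq_addr. Qed.

Lemma sum_creation_out (m : occ) j l (g : (E -> nat) -> R) :
  (forall m1 m2, m1 =1 m2 -> g m1 = g m2) -> (total m < L)%N ->
  \sum_(m' : occ) creation ed b (j, m) (l, m') * g (occn m') =
  b j l * sqrtn (m (ed j l)).+1 * g (incr (occn m) (ed j l)).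
Proof.
move=> gE mL; set e := ed j l.
pose m1 : occ := [ffun f => inord (m f + (f == e))].
have m1E f : m1 f = incr (occn m) e f :> nat.
  rewrite ffunE inordK// ltnS (leq_trans _ mL)// -[(total m).+1]addn1.
  by rewrite leq_add ?occ_le_total// leq_b1.
have um1 : up e m m1 by apply/upP.
rewrite (bigD1 m1)//= big1 ?addr0 => [|m' m'm1].
  rewrite /creation /creates/= -/e um1 (total_up um1) mL/= m1E /incr eqxx addn1.
  by congr (_ * _); exact: gE.
rewrite /creation /creates/= -/e; case: ifP => [/andP[um' _]|_]; rewrite ?mul0r//.
by rewrite (up_injr um1 um') eqxx in m'm1.
Qed.

Lemma sum_creation_in (m : occ) j l (g : (E -> nat) -> R) :
  (forall m1 m2, m1 =1 m2 -> g m1 = g m2) -> (total m <= L)%N ->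
  \sum_(m' : occ) creation ed b (l, m') (j, m) * g (occn m') =
  b j l * sqrtn (m (ed j l)) * g (decr (occn m) (ed j l)).
Proof.
move=> gE mL; set e := ed j l.
(* On an empty edge both sides vanish, which disposes of the truncated case of [decr]. *)
have [me0|me_gt0] := posnP (m e).
  rewrite me0 sqrtr0 mulr0 mul0r big1// => m' _.
  by rewrite /creation/= ed_sym -/e me0 sqrtr0 mulr0 if_same mul0r.
pose m1 : occ := [ffun f => inord (m f - (f == e))].
have m1E f : m1 f = decr (occn m) e f :> nat.
  by rewrite ffunE inordK// ltnS (leq_trans (leq_subr _ _))// -ltnS.
have um1 : up e m1 m.
  apply/upP => f; rewrite m1E /decr subnK//.
  by case: eqP => [->|].
rewrite (bigD1 m1)//= big1 ?addr0 => [|m' m'm1].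
  rewrite /creation /creates/= [ed l j]ed_sym -/e um1 mL/= b_sym.
  by congr (_ * _); exact: gE.
rewrite /creation /creates/= [ed l j]ed_sym -/e.
case: ifP => [/andP[um' _]|_]; rewrite ?mul0r//.
by rewrite (up_injl um1 um') eqxx in m'm1.
Qed.

(** Induction along the walk: [wick_cons] splits the first step into the two parts of [hop]. A step
    creates at most one particle, so the hypothesis keeps the remaining steps within the cutoff. *)
Lemma walk_sum_hop k i j (m : occ) : (k + total m <= L)%N ->
  walk_sum k i j (fun s => walk_weight s (occn m)) =
  iter k (hop_op (L := L) ed b) (start R i) (j, m).
Proof.
have wE m1 m2 s : m1 =1 m2 -> walk_weight s m1 = walk_weight s m2.
  by move=> m12; rewrite /walk_weight (eq_wick _ _ m12).
elim: k j m => [|k IH] j m kL.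
  rewrite /= /walk_weight big_nil mul1r wick_nil// /start -natrM mulnb xpair_eqE.
  congr (_ && _)%:R; apply/forallP/eqP => [m0|-> e]; last by rewrite ffunE.
  by apply/ffunP => e; apply/val_inj; rewrite ffunE; apply/eqP; exact: m0.
have mL : (total m < L)%N by rewrite (leq_trans _ kL)// addSn ltnS leq_addl.
rewrite iterS /hop_op sum_state [LHS]/=; apply: eq_bigr => l _.
pose g (m : E -> nat) := walk_sum k i l (fun s => walk_weight s m).
have gE m1 m2 : m1 =1 m2 -> g m1 = g m2.
  by move=> m12; apply: eq_walk_sum => s; exact: wE.
transitivity (b j l * sqrtn (m (ed j l)).+1 * g (incr (occn m) (ed j l)) +
    b j l * sqrtn (m (ed j l)) * g (decr (occn m) (ed j l))).
  rewrite -!walk_sumZ -walk_sumD; apply: eq_walk_sum => s.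
  rewrite /walk_weight big_cons/= wick_cons; ring.
rewrite -(sum_creation_out _ _ gE mL) -(sum_creation_in _ _ gE (ltnW mL)).
rewrite -big_split; apply: eq_bigr => m' _ /=; rewrite /hop mulrDl.
rewrite /creation /creates/=; congr (_ + _).
  case: ifP => [/andP[um' _]|_]; last by rewrite !mul0r.
  by rewrite /g IH// (total_up um') addnS -addSn.
case: ifP => [/andP[um' _]|_]; last by rewrite !mul0r.
rewrite /g IH//; apply: leq_trans kL; rewrite (total_up um') addnS -addSn; lia.
Qed.

End FockWalks.

(** * Comparison of two weights along closed walks *)

Lemma prod_le_mean_exp (R : realFieldType) (T : eqType) (l : seq T) (y : T -> R) :
  {in l, forall x, 0 <= y x} -> (0 < size l)%N ->
  \prod_(x <- l) y x <= (\sum_(x <- l) y x ^+ size l) / (size l)%:R.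
Proof.
case: l => // x0 l'; set l := x0 :: l' => y0 _.
rewrite (big_nth x0) [X in _ <= X / _](big_nth x0) !big_mkord.
have := @leif_AGM _ 'I_(size l) predT (fun i => y (nth x0 l i) ^+ size l).
rewrite card_ord /= => -[i _|+ _].
  by rewrite exprn_ge0// y0// mem_nth.
have yi (i : 'I_(size l)) : 0 <= y (nth x0 l i) by rewrite y0// mem_nth.
rewrite prodrXl ler_pXn2r// nnegrE ?prodr_ge0// divr_ge0// sumr_ge0// => i _.
by rewrite exprn_ge0.
Qed.

Section ClosedWalkBound.
Variables (R : rcfType) (I E : finType) (ed : I -> I -> E).
Variables (mu : {scalar {poly R}}).
Hypothesis mu_hermite : forall n, mu (hermite R n) = (n == 0)%:R.
Hypothesis ed_sym : forall i j, ed i j = ed j i.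
Hypothesis ed_inj : forall i j k l, ed i j = ed k l ->
  (i = k /\ j = l) \/ (i = l /\ j = k).

Local Notation weight := (walk_weight ed mu).
Local Notation no_edge := (fun=> 0%N).

(** A walk of [2 * p] steps from the vacuum fits under the cutoff [L = 2 * p]. *)
Lemma closed_walk_sum_bound (b : I -> I -> R) (A B : R) p i :
  0 < A -> 0 < B -> (0 < p)%N ->
  (forall i j, 0 <= b i j) -> (forall i j, b i j = b j i) ->
  (forall i, \sum_j b i j ^+ 2 <= A ^+ 2) -> (forall i j, b i j <= B) ->
  walk_sum (2 * p) i i (fun s => weight b s no_edge) <=
  A ^+ 2 * (2 * A + 4 * B * Num.sqrt (2 * p)%:R) ^+ (2 * p.-1).
Proof.
move=> A0 B0 p0 b0 bsym brow bB.
have L0 : (0 < 2 * p)%N by rewrite muln_gt0.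
rewrite (le_trans _ (hop_moment ed_sym ed_inj A0 B0 L0 b0 brow bB i p0))//.
have vac0 : total (vacuum E (2 * p)) = 0%N.
  by rewrite /total big1// => e _; rewrite ffunE.
rewrite -(walk_sum_hop mu_hermite bsym ed_sym) ?vac0 ?addn0//.
rewrite le_eqVlt; apply/orP; left; apply/eqP/eq_walk_sum => s.
by rewrite /walk_weight; congr (_ * _); apply: eq_wick => e; rewrite ffunE.
Qed.

Variables (b b' : I -> I -> R) (lam : I -> R).
Hypothesis lam_ge0 : forall i, 0 <= lam i.
Hypothesis b_ge0 : forall i j, 0 <= b i j.
Hypothesis b'_ge0 : forall i j, 0 <= b' i j.
Hypothesis b_le : forall i j, b i j <= Num.max (lam i) (lam j) * b' i j.

Lemma weight_rot k s : weight b' (steps (rot k s)) no_edge = weight b' (steps s) no_edge.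
Proof.
rewrite /walk_weight (perm_big _ (perm_steps_rot k s))/=; congr (_ * _).
by apply: perm_wick; apply: perm_map; exact: perm_steps_rot.
Qed.

Lemma weight_ge0 s : 0 <= weight b' s no_edge.
Proof. by rewrite mulr_ge0 ?wick_ge0// prodr_ge0. Qed.

(** Bound [b] factor by factor, then the product of the maxima by the mean of their powers. *)
Lemma weight_le (s : seq I) : (0 < size s)%N ->
  weight b (steps s) no_edge <=
  2 / (size s)%:R * \sum_(a <- s) lam a ^+ size s * weight b' (steps s) no_edge.
Proof.
move=> s0; set N := size s.
have sizeE : size (steps s) = N by rewrite size_zip size_rot minnn.
apply: (@le_trans _ _ ((\prod_(x <- steps s) Num.max (lam x.1) (lam x.2)) *
    weight b' (steps s) no_edge)).
  rewrite /walk_weight mulrA ler_wpM2r ?wick_ge0//.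
  rewrite -big_split/= ler_prod// => x _; rewrite b_ge0/= b_le//.
rewrite -mulr_suml [leRHS]mulrA ler_wpM2r ?weight_ge0//.
apply: (le_trans (prod_le_mean_exp _ _)) => [x _||]; rewrite ?sizeE//.
  by rewrite le_max lam_ge0.
rewrite mulrAC ler_pM2r ?invr_gt0 ?ltr0n//.
apply: (@le_trans _ _ (\sum_(x <- steps s) (lam x.1 ^+ N + lam x.2 ^+ N))).
  apply: ler_sum => x _; case: (leP (lam x.1)) => _; [rewrite lerDr|rewrite lerDl];
  by rewrite exprn_ge0.
rewrite big_split/= -(big_map fst predT (fun a => lam a ^+ N)).
rewrite -(big_map snd predT (fun a => lam a ^+ N)) -/(unzip1 _) -/(unzip2 _).
rewrite unzip1_zip ?unzip2_zip ?size_rot//.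
by rewrite [X in _ + X](perm_big s)/= ?perm_rot// mulr_natl mulr2n.
Qed.

(* Every position along a walk can be rotated to the base point, and each of
   them belongs to two steps, whence the factor 2. *)
Lemma sum_weight_le q :
  \sum_i walk_sum q.+1 i i (fun s => weight b s no_edge) <=
  2 * \sum_i lam i ^+ q.+1 * walk_sum q.+1 i i (fun s => weight b' s no_edge).
Proof.
have := sum_closed_walks q (fun s => weight b s no_edge) (fun=> 1).
under [RHS]eq_bigr do rewrite mul1r.
move=> <-; rewrite -sum_closed_walks.
apply: (@le_trans _ _ (\sum_(s : q.+1.-tuple I) \sum_(k < q.+1)
   2 / q.+1%:R * (lam (tnth s k) ^+ q.+1 * weight b' (steps s) no_edge))).
  apply: ler_sum => s _; rewrite mul1r (le_trans (weight_le _)) ?size_tuple//.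
  by rewrite mulr_sumr big_tuple.
rewrite exchange_big/=.
rewrite (eq_bigr (fun=> 2 / q.+1%:R * \sum_(s : q.+1.-tuple I)
    (lam (thead s) ^+ q.+1 * weight b' (steps s) no_edge))).
  by rewrite sumr_const card_ord -mulrnAl -[_ *+ _]mulr_natr divfK ?pnatr_eq0.
move=> k _; rewrite -mulr_sumr; congr (_ * _).
(* Rotation by [k] brings position [k] to the head and preserves the weight. *)
rewrite [RHS](reindex (fun s : q.+1.-tuple I => [tuple of rot k s]))/=; last first.
  exists (fun s : q.+1.-tuple I => [tuple of rotr k s]) => s _; apply: val_inj => /=.
    exact: rotK.
  exact: rotrK.
apply: eq_bigr => s _; rewrite weight_rot; congr (lam _ ^+ _ * _).
rewrite /thead (tnth_nth (tnth s k)) [RHS](tnth_nth (tnth s k))/=.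
by rewrite /rot nth_cat size_drop size_tuple subn_gt0 ltn_ord nth_drop addn0.
Qed.

Theorem closed_walk_bound (A B : R) p :
  0 < A -> 0 < B -> (0 < p)%N -> \sum_i lam i ^+ (2 * p) <= 2 ->
  (forall i j, b' i j = b' j i) ->
  (forall i, \sum_j b' i j ^+ 2 <= A ^+ 2) -> (forall i j, b' i j <= B) ->
  \sum_i walk_sum (2 * p) i i (fun s => weight b s no_edge) <=
  (2 * A + 4 * B * Num.sqrt (2 * p)%:R) ^+ (2 * p).
Proof.
move=> A0 B0 p0 lam2 bsym brow bB.
set K := 2 * A + _.
have K0 : 2 * A <= K by rewrite lerDl mulr_ge0 ?sqrtr_ge0// mulr_ge0// ltW.
have pE : (2 * p = (2 * p.-1).+2)%N by lia.
rewrite {1}pE; apply: (le_trans (sum_weight_le _)); rewrite -pE.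
apply: (@le_trans _ _ (2 * \sum_i lam i ^+ (2 * p) * (A ^+ 2 * K ^+ (2 * p.-1)))).
  rewrite ler_pM2l// ler_sum// => i _; rewrite ler_wpM2l ?exprn_ge0//.
  exact: closed_walk_sum_bound.
rewrite -mulr_suml mulrA.
have KK : 0 <= A ^+ 2 * K ^+ (2 * p.-1).
  by rewrite mulr_ge0 ?sqr_ge0// exprn_ge0// (le_trans _ K0)// mulr_ge0// ltW.
(* One factor 2 comes from [sum_weight_le], the other from the sum of the powers of [lam];
   [2 A <= K] absorbs both. *)
apply: (@le_trans _ _ (2 * 2 * (A ^+ 2 * K ^+ (2 * p.-1)))).
  by rewrite ler_wpM2r// ler_pM2l.
have -> : K ^+ (2 * p) = K * K * K ^+ (2 * p.-1) by rewrite {1}pE 2!exprS mulrA.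
rewrite mulrA ler_wpM2r ?exprn_ge0//.
  by rewrite (le_trans _ K0)// mulr_ge0// ltW.
have -> : 2 * 2 * A ^+ 2 = (2 * A) * (2 * A) by ring.
by rewrite ler_pM// mulr_ge0// ltW.
Qed.

End ClosedWalkBound.

(** * Reduction to uniformly bounded rows and entries *)

Theorem closed_walk_Schatten_bound (R : rcfType) (I E : finType) (ed : I -> I -> E)
    (mu : {scalar {poly R}}) (b : I -> I -> R) (sigma s : I -> R) (A B : R) p :
  (forall n, mu (hermite R n) = (n == 0)%:R) ->
  (forall i j, ed i j = ed j i) ->
  (forall i j k l, ed i j = ed k l -> (i = k /\ j = l) \/ (i = l /\ j = k)) ->
  (forall i j, 0 <= b i j) -> (forall i j, b i j = b j i) ->
  (forall i, 0 <= sigma i) -> (forall i, sigma i ^+ 2 = \sum_j b i j ^+ 2) ->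
  (forall i j, b i j <= s i) -> (forall i, 0 <= s i) ->
  0 < A -> \sum_i sigma i ^+ (2 * p) <= A ^+ (2 * p) ->
  0 < B -> \sum_i s i ^+ (2 * p) <= B ^+ (2 * p) -> (0 < p)%N ->
  \sum_i walk_sum (2 * p) i i (fun w => walk_weight ed mu b w (fun=> 0%N)) <=
  (2 * A + 4 * B * Num.sqrt (2 * p)%:R) ^+ (2 * p).
Proof.
move=> mu_h ed_sym ed_inj b0 bsym sig0 sigE bs s0 A0 sigA B0 sB p0.
pose lam i := Num.max (sigma i / A) (s i / B).
pose m i j := Num.max (lam i) (lam j).
have lam_sig i : sigma i <= lam i * A by rewrite -ler_pdivrMr// le_max lexx.
have lam_s i : s i <= lam i * B by rewrite -ler_pdivrMr// le_max lexx orbT.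
have lam0 i : 0 <= lam i by rewrite le_max divr_ge0// ltW.
have lam_m i j : lam i <= m i j by rewrite le_max lexx.
have m0 i j : 0 <= m i j by exact: le_trans (lam_m i j).
have b_lam0 i j : lam i = 0 -> b i j = 0.
  move=> li; apply/eqP; rewrite eq_le b0 andbT (le_trans (bs i j))//.
  by rewrite (le_trans (lam_s i))// li mul0r.
(* The divisor vanishes only if row [i] does, and then [0 / 0 = 0]. *)
pose b' i j := b i j / m i j.
have b'0 i j : 0 <= b' i j by rewrite divr_ge0.
apply: (@closed_walk_bound _ _ _ _ _ mu_h ed_sym ed_inj b b' lam) => //.
- move=> i j; have [mij|mij] := eqVneq (m i j) 0; last first.
    by rewrite -/(m i j) mulrC divfK.
  have li : lam i = 0 by apply/eqP; rewrite eq_le lam0 andbT -mij lam_m.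
  rewrite b_lam0//; apply: mulr_ge0 => //; exact: m0.
(* The power of a maximum is at most the sum of the powers, and each normalized sum is at most 1. *)
- apply: (@le_trans _ _ (\sum_i (sigma i ^+ (2 * p) / A ^+ (2 * p) +
      s i ^+ (2 * p) / B ^+ (2 * p)))).
    apply: ler_sum => i _; rewrite -!expr_div_n /lam.
    by case: (leP (sigma i / A)) => _; rewrite ?lerDl ?lerDr exprn_ge0// divr_ge0// ltW.
  have A2p : 0 < A ^+ (2 * p) by rewrite exprn_gt0.
  have B2p : 0 < B ^+ (2 * p) by rewrite exprn_gt0.
  rewrite big_split/= -!mulr_suml -[2]/(1 + 1 : R) lerD//.
    by rewrite ler_pdivrMr// mul1r.
  by rewrite ler_pdivrMr// mul1r.
- by move=> i j; rewrite /b' bsym /m maxC.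
(* As [lam i <= m i j], the row sum is at most [sigma i ^+ 2 / lam i ^+ 2], hence at most
   [A ^+ 2]. *)
- move=> i; have [li|li] := eqVneq (lam i) 0.
    by rewrite big1 ?sqr_ge0// => j _; rewrite /b' b_lam0// mul0r expr0n.
  have li_gt0 : 0 < lam i by rewrite lt_def li lam0.
  apply: (@le_trans _ _ (\sum_j b i j ^+ 2 / lam i ^+ 2)).
    apply: ler_sum => j _; rewrite expr_div_n ler_wpM2l ?sqr_ge0//.
    have mij : 0 < m i j by exact: lt_le_trans (lam_m i j).
    by rewrite lef_pV2 ?posrE ?exprn_gt0// lerXn2r ?nnegrE.
  rewrite -mulr_suml -sigE ler_pdivrMr ?exprn_gt0// -exprMn mulrC.
  by rewrite lerXn2r ?nnegrE// mulr_ge0// ltW.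
- move=> i j; rewrite /b'; have [->|mij] := eqVneq (m i j) 0.
    by rewrite invr0 mulr0 ltW.
  have mij0 : 0 < m i j by rewrite lt_def mij m0.
  rewrite ler_pdivrMr// (le_trans (bs i j))// (le_trans (lam_s i))// mulrC.
  by rewrite ler_pM2l.
Qed.

Local Open Scope classical_set_scope.
Local Open Scope ring_scope.

(** * Expectations of products of independent variables *)

Section Transfer.
Local Open Scope ereal_scope.
Context d d' (T : measurableType d) (Y : measurableType d') (R : realType).
Variables (mu : {measure set T -> \bar R}) (nu : {measure set Y -> \bar R}).
Variables (X : T -> Y) (H : T -> R).
Hypotheses (mX : measurable_fun setT X) (mH : measurable_fun setT H).
Hypothesis H0 : forall x, (0 <= H x)%R.
Hypothesis HX : forall A, measurable A -> \int[mu]_(x in X @^-1` A) (H x)%:E = nu A.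

Import HBNNSimple.

Let nnsfun_transfer (h : {nnsfun Y >-> R}) :
  \int[mu]_x (h (X x) * H x)%:E = \int[nu]_y (h y)%:E.
Proof.
have mX1 r : measurable (X @^-1` (h @^-1` [set r])).
  by rewrite -[X in measurable X]setTI; exact: mX.
rewrite integralT_nnsfun sintegralE.
transitivity (\sum_(r \in range h)
    \int[mu]_x (r%:E * (\1_(X @^-1` (h @^-1` [set r])) x * H x)%:E)).
  rewrite -ge0_integral_fsum//; last 2 first.
  - move=> r; apply: measurable_funeM; apply/measurable_EFinP.
    by apply: measurable_funM => //; exact: measurable_indic.
  - move=> r x _; rewrite -EFinM lee_fin mulrA mulr_ge0//.
    have [/= xr|xr] := pselect (h (X x) = r); first by rewrite -xr mulr_ge0.
    by rewrite indicE memNset// mulr0.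
  apply: eq_integral => x _; rewrite fimfunE EFinM -fsumEFin//.
  rewrite ge0_mule_fsuml => [|r]; last by rewrite EFinM nnfun_muleindic_ge0.
  by apply: eq_fsbigr => r _; rewrite -!EFinM mulrA.
apply: eq_fsbigr => r; rewrite inE => -[y _ <-].
rewrite ge0_integralZl//; last 3 first.
- apply/measurable_EFinP; apply: measurable_funM => //; exact: measurable_indic.
- by move=> x _; rewrite lee_fin mulr_ge0.
- by rewrite lee_fin.
congr (_ * _); rewrite -HX; last exact: measurable_sfunP.
rewrite [RHS]integral_mkcond; apply: eq_integral => x _.
rewrite patchE indicE; case: ifPn => xA; rewrite ?mul1r ?mul0r//.
Qed.

(* [nu] is the image under [X] of the measure of density [H] with respect to
   [mu]. *)
Lemma ge0_integral_transfer (f : Y -> R) : measurable_fun setT f ->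
  (forall y, 0 <= f y)%R ->
  \int[mu]_x (f (X x) * H x)%:E = \int[nu]_y (f y)%:E.
Proof.
move=> mf f0.
have mEf : measurable_fun setT (EFin \o f) by exact/measurable_EFinP.
pose f_ := nnsfun_approx measurableT mEf.
have cf y : (f_ n y)%:E @[n --> \oo] --> (f y)%:E.
  by apply: (cvg_nnsfun_approx measurableT mEf) => // z _; rewrite lee_fin.
have ndf y : {homo (fun n => f_ n y) : m n / (m <= n)%N >-> (m <= n)%R}.
  by move=> m n mn; exact/lefP/nd_nnsfun_approx.
transitivity (limn (fun n => \int[mu]_x (f_ n (X x) * H x)%:E)).
  rewrite -monotone_convergence//.
  - apply: eq_integral => x _; apply/esym/cvg_lim => //.
    under eq_fun do rewrite EFinM.
    by rewrite EFinM; apply: cvgeM => //; exact: cvg_cst.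
  - move=> n; apply/measurable_EFinP; apply: measurable_funM => //.
    exact: measurableT_comp.
  - by move=> n x _; rewrite lee_fin mulr_ge0.
  - by move=> x _ m n mn; rewrite lee_fin ler_wpM2r// ndf.
under eq_fun do rewrite nnsfun_transfer.
rewrite -monotone_convergence//.
- by apply: eq_integral => y _; exact/cvg_lim.
- by move=> n; exact/measurable_EFinP.
- by move=> n y _; rewrite lee_fin.
- by move=> y _ m n mn; rewrite lee_fin ndf.
Qed.

(** The positive and negative parts are transferred separately; multiplication by [H >= 0] commutes
    with taking them. *)
Lemma integral_transfer (f : Y -> R) : measurable_fun setT f ->
  \int[mu]_x (f (X x) * H x)%:E = \int[nu]_y (f y)%:E.
Proof.
move=> mf.
pose fp y := Num.max (f y) 0%R; pose fn y := Num.max (- f y)%R 0%R.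
have mfp : measurable_fun setT fp.
  by apply: measurable_maxr => //; exact: measurable_cst.
have mfn : measurable_fun setT fn.
  by apply: measurable_maxr; [exact: measurableT_comp|exact: measurable_cst].
rewrite integralE [RHS]integralE; congr (_ - _).
- transitivity (\int[nu]_y (fp y)%:E); last first.
    by apply: eq_integral => y _; rewrite funeposE -EFin_max.
  rewrite -ge0_integral_transfer => [|//|y]; last by rewrite /fp le_max lexx orbT.
  apply: eq_integral => x _; rewrite funeposE -EFin_max /fp.
  by rewrite maxr_pMl// mul0r.
- transitivity (\int[nu]_y (fn y)%:E); last first.
    by apply: eq_integral => y _; rewrite funenegE -EFinN -EFin_max.
  rewrite -ge0_integral_transfer => [|//|y]; last by rewrite /fn le_max lexx orbT.
  apply: eq_integral => x _; rewrite funenegE -EFinN -EFin_max /fn.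
  by rewrite maxr_pMl// mul0r mulNr.
Qed.

End Transfer.

Section Independence.
Context (d : measure_display) (T : measurableType d) (R : realType).
Variables (P : probability T R) (I : choiceType) (D : set I).
Variable g : I -> {RV P >-> R}.
Hypothesis indep : mutually_independent D g.

Let mg i : measurable_fun setT (g i). Proof. exact: measurable_funP. Qed.

Let mpre i (A : set R) : measurable A -> measurable (g i @^-1` A).
Proof. by move=> mA; rewrite -[X in measurable X]setTI; exact: mg. Qed.

Let ev i (f : R -> R) : R := fine (\int[P]_w (f (g i w))%:E)%E.
Let pr i (A : set R) : R := fine (P (g i @^-1` A)).

(** The product of indicators is the indicator of the intersection in the definition of
    independence. *)
Let indep_indic l (A : I -> set R) : uniq l -> {in l, forall i, D i} ->
  (forall i, measurable (A i)) ->
  (\int[P]_w (\prod_(i <- l) \1_(A i) (g i w))%:E)%E =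
  (\prod_(i <- l) pr i (A i))%:E.
Proof.
move=> ul lD mA; pose J := [fset i in l]%fset.
have Jl : perm_eq J l.
  by apply: uniq_perm => // i; rewrite !inE.
have PJ := indep (J := J) _ mA; rewrite (perm_big _ Jl)/= in PJ.
rewrite /pr -prodEFin (eq_bigr (fun i => P (g i @^-1` A i))) => [|i _]; last first.
  by rewrite fineK// fin_num_measure//; exact: mpre.
rewrite -PJ; last by move=> i /=; rewrite !inE; exact: lD.
set B := \bigcap_(i in _) _.
have mB : measurable B.
  by apply: fin_bigcap_measurable => // i _; exact: mpre.
rewrite -[B in RHS]setIT -integral_indic//; apply: eq_integral => w _; congr EFin.
have [wB|] := pselect (B w).
  rewrite indicE mem_set// big_seq big1// => i il; rewrite indicE mem_set//.
  by apply: wB; rewrite /= !inE.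
rewrite indicE => wB; rewrite memNset//.
have [i il wi] : exists2 i, i \in l & ~ A i (g i w).
  apply: contrapT => h; apply: wB => i /=; rewrite !inE => il.
  by apply: contrapT => wi; apply: h; exists i.
by rewrite (big_rem i)//= indicE memNset// mul0r.
Qed.

(** Indicators are exchanged for functions one index at a time. With an arbitrary set [B] at [i],
    the induction hypothesis says that the measure of density [H] has as image under [g i] a
    multiple of the law of [g i]. *)
Let indep_mixed l1 l2 (f : I -> R -> R) (A : I -> set R) :
  uniq (l1 ++ l2) -> {in l1 ++ l2, forall i, D i} ->
  (forall i, measurable (A i)) ->
  (forall i, measurable_fun setT (f i)) -> (forall i x, i \in l1 -> 0 <= f i x) ->
  (forall i, P.-integrable setT (fun w => (f i (g i w))%:E)) ->
  (\int[P]_w (\prod_(i <- l1) f i (g i w) * \prod_(i <- l2) \1_(A i) (g i w))%:E)%E =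
  (\prod_(i <- l1) ev i (f i) * \prod_(i <- l2) pr i (A i))%:E.
Proof.
move=> ul lD mA mf + intf; elim: l1 => [|i l1 IH] in l2 A mA ul lD * => f0.
  by rewrite big_nil mul1r -indep_indic//; under eq_integral do rewrite big_nil mul1r.
have mprod (l : seq I) (h : I -> R -> R) : (forall i, measurable_fun setT (h i)) ->
    measurable_fun setT (fun w => \prod_(i <- l) h i (g i w)).
  by move=> mh; apply: measurable_prod => j _; exact: measurableT_comp.
have f0' j x : j \in l1 -> 0 <= f j x by move=> jl; rewrite f0// inE jl orbT.
pose H w := \prod_(i <- l1) f i (g i w) * \prod_(i <- l2) \1_(A i) (g i w).
have mH : measurable_fun setT H.
  apply: measurable_funM; first exact: (mprod l1 f).
  by apply: (mprod l2 (fun j => \1_(A j))) => j; exact: measurable_indic.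
have H0 w : 0 <= H w.
  by rewrite mulr_ge0// big_seq prodr_ge0// => j jl; exact: f0'.
have pr0 j B : 0 <= pr j B by rewrite fine_ge0.
have c0 : 0 <= \prod_(i <- l1) ev i (f i) * \prod_(i <- l2) pr i (A i).
  apply: mulr_ge0; last exact: prodr_ge0.
  rewrite big_seq prodr_ge0// => j jl.
  by rewrite fine_ge0// integral_ge0// => w _; rewrite lee_fin f0'.
pose c := NngNum c0.
have HX (B : set R) : measurable B ->
    (\int[P]_(w in g i @^-1` B) (H w)%:E)%E = mscale c (distribution P (g i)) B.
  move=> mB; pose A' j := if j == i then B else A j.
  have mA' j : measurable (A' j) by rewrite /A'; case: ifP.
  have Ai (F : I -> set R -> R) :
      \prod_(j <- i :: l2) F j (A' j) = F i B * \prod_(j <- l2) F j (A j).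
    rewrite big_cons /A' eqxx; congr (_ * _); apply: eq_big_seq => j jl.
    case: eqP => // ji; move: ul; rewrite /= mem_cat -ji jl orbT//.
  have pm : perm_eq (l1 ++ i :: l2) (i :: l1 ++ l2).
    by rewrite -(cat1s i l2) perm_catCA.
  have := IH (i :: l2) A' mA'; rewrite (perm_uniq pm) => /(_ ul).
  have lD2 : {in l1 ++ i :: l2, forall j, D j}.
    by move=> j; rewrite (perm_mem pm); exact: lD.
  move=> /(_ lD2 f0'); rewrite (Ai (fun j B => pr j B)) => IHi.
  rewrite integral_mkcond [RHS](_ : _ = (\prod_(i <- l1) ev i (f i) *
      (pr i B * \prod_(j <- l2) pr j (A j)))%:E); last first.
    rewrite /mscale/= mulrCA [RHS]EFinM muleC /pr fineK//.
    by rewrite fin_num_measure//; exact: mpre.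
  rewrite -IHi; apply: eq_integral => w _.
  rewrite (Ai (fun j B => \1_B (g j w))) patchE /H mulrCA indicE.
  by rewrite -[w \in _]/(g i w \in B); case: ifP => _; rewrite ?mul1r ?mul0r.
have fi0 x : 0 <= f i x by rewrite f0// mem_head.
under eq_integral do rewrite big_cons -mulrA.
rewrite (ge0_integral_transfer (mg i) mH H0 HX (mf i) fi0).
rewrite ge0_integral_mscale//=; last 2 first.
- exact/measurable_EFinP.
- by move=> x _; rewrite lee_fin.
rewrite ge0_integral_distribution//; last first.
  by apply/measurable_EFinP; exact: (mf i).
rewrite [X in (_ * X)%E](_ : _ = (ev i (f i))%:E).
  by rewrite -EFinM mulrC big_cons -mulrA.
by rewrite /ev fineK//; exact: integrable_fin_num.
Qed.

Lemma indep_integral_prod (l : seq I) (f : I -> R -> R) :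
  uniq l -> {in l, forall i, D i} ->
  (forall i, measurable_fun setT (f i)) ->
  (forall i, P.-integrable setT (fun w => (f i (g i w))%:E)) ->
  P.-integrable setT (fun w => (\prod_(i <- l) f i (g i w))%:E) /\
  (\int[P]_w (\prod_(i <- l) f i (g i w))%:E)%E =
  (\prod_(i <- l) fine (\int[P]_w (f i (g i w))%:E)%E)%:E.
Proof.
move=> ul lD.
(* Indices in [l1] may carry functions of any sign; they are split one at a
   time into positive and negative parts. *)
suff main (l1 : seq I) (h : I -> R -> R) :
    (forall i, measurable_fun setT (h i)) ->
    (forall i, P.-integrable setT (fun w => (h i (g i w))%:E)) ->
    (forall i x, i \in l -> i \notin l1 -> 0 <= h i x) ->
    P.-integrable setT (fun w => (\prod_(i <- l) h i (g i w))%:E) /\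
    (\int[P]_w (\prod_(i <- l) h i (g i w))%:E)%E = (\prod_(i <- l) ev i (h i))%:E.
  by move=> mf intf; apply: (main l f mf intf) => i x ->.
elim: l1 h => [|i l1 IH] h mh inth h0.
  have E : (\int[P]_w (\prod_(i <- l) h i (g i w))%:E)%E = (\prod_(i <- l) ev i (h i))%:E.
    have := @indep_mixed l [::] h (fun=> setT).
    rewrite cats0 big_nil mulr1 => <-//; last by move=> i x il; exact: h0.
    by under [RHS]eq_integral do rewrite big_nil mulr1.
  split=> //; apply/integrableP; split.
    apply/measurable_EFinP; apply: measurable_prod => j _; exact: measurableT_comp.
  under eq_integral => w _.
    rewrite gee0_abs; last first.
      by rewrite lee_fin big_seq prodr_ge0// => j jl; exact: h0.
    over.
  by rewrite E ltry.
have [il|il] := boolP (i \in l); last first.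
  apply: IH => // j x jl jl1; apply: h0 => //.
  by rewrite inE negb_or jl1 andbT; apply: contraNneq il => <-.
pose part (u : R -> R) j := if j == i then u else h j.
pose hp := part (fun x => Num.max (h i x) 0).
pose hn := part (fun x => Num.max (- h i x) 0).
have mp : measurable_fun setT (fun x => Num.max (h i x) 0).
  by apply: measurable_maxr => //; exact: measurable_cst.
have mn : measurable_fun setT (fun x => Num.max (- h i x) 0).
  by apply: measurable_maxr; [exact: measurableT_comp|exact: measurable_cst].
have part_int (u : R -> R) : measurable_fun setT u -> (forall x, `|u x| <= `|h i x|) ->
    forall j, P.-integrable setT (fun w => (part u j (g j w))%:E).
  move=> mu uh j; rewrite /part; case: eqP => // ->.
  apply: le_integrable (inth i) => //.
    by apply/measurable_EFinP; exact: measurableT_comp.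
  by move=> w _ /=; rewrite lee_fin.
have part_le (e : bool) x : `|Num.max ((-1) ^+ e * h i x) 0| <= `|h i x|.
  by rewrite ger0_norm ?le_max ?lexx ?orbT// ge_max normr_ge0 andbT
    (le_trans (ler_norm _))// normrMsign.
have IHpart (u : R -> R) : measurable_fun setT u -> (forall x, `|u x| <= `|h i x|) ->
    (forall x, 0 <= u x) ->
    P.-integrable setT (fun w => (\prod_(j <- l) part u j (g j w))%:E) /\
    (\int[P]_w (\prod_(j <- l) part u j (g j w))%:E)%E =
    (\prod_(j <- l) ev j (part u j))%:E.
  move=> mu uh u0; apply: IH => [j||j x jl jl1].
  - by rewrite /part; case: ifP.
  - exact: part_int.
  - rewrite /part; case: ifPn => // ji; apply: h0 => //.
    by rewrite inE negb_or ji.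
have part_leP x : `|Num.max (h i x) 0| <= `|h i x|.
  by have := part_le false x; rewrite mul1r.
have part_leN x : `|Num.max (- h i x) 0| <= `|h i x|.
  by have := part_le true x; rewrite mulN1r.
have [|intp Ep] := IHpart _ mp part_leP; first by move=> x; rewrite le_max lexx orbT.
have [|intn En] := IHpart _ mn part_leN; first by move=> x; rewrite le_max lexx orbT.
(* As [l] has no repetition, exactly one factor depends on [u], and the product is linear in it. *)
have split_prod (F : I -> (R -> R) -> R) u :
    \prod_(j <- l) F j (part u j) =
    F i u * \prod_(j <- l | j != i) F j (h j).
  rewrite (bigD1_seq i)//= /part eqxx; congr (_ * _).
  by apply: eq_bigr => j /negPf ->.
have splitx x : h i x = Num.max (h i x) 0 - Num.max (- h i x) 0.
  by rewrite !maxEle; case: ifP; case: ifP; lra.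
have Eh w : \prod_(j <- l) h j (g j w) =
    \prod_(j <- l) hp j (g j w) - \prod_(j <- l) hn j (g j w).
  rewrite !(split_prod (fun j u => u (g j w))) -mulrBl -splitx.
  by rewrite (bigD1_seq i).
have -> : (fun w => (\prod_(j <- l) h j (g j w))%:E) =
    (fun w => (\prod_(j <- l) hp j (g j w))%:E - (\prod_(j <- l) hn j (g j w))%:E)%E.
  by apply/funext => w; rewrite Eh EFinB.
split; first exact: integrableB.
rewrite integralB//= Ep En -EFinB; congr EFin.
rewrite !split_prod -mulrBl (bigD1_seq i)//=; congr (_ * _).
rewrite /ev; under [in RHS]eq_integral do rewrite splitx EFinB.
have := part_int _ mp part_leP i; rewrite /part eqxx => ip.
have := part_int _ mn part_leN i; rewrite /part eqxx => jp.
by rewrite integralB// [RHS]fineB ?integrable_fin_num.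
Qed.

End Independence.

(** * Moments of the standard Gaussian law *)

(** The double factorial [(k-1)!!] for even [k], and 0 for odd [k]. *)
Fixpoint gauss_moment (k : nat) : nat :=
  match k with
  | 0 => 1
  | 1 => 0
  | k'.+2 => k'.+1 * gauss_moment k'
  end.

Section GaussMoments.
Variable R : realType.
Local Notation leb := (@lebesgue_measure R).

Definition bell (x : R) : R := expR (- x ^+ 2 / 2).

Lemma bell_ge0 x : 0 <= bell x. Proof. exact: expR_ge0. Qed.

Lemma normal_pdf_bell x : normal_pdf 0 1 x = normal_peak 1 * bell x.
Proof.
by rewrite normal_pdfE ?oner_neq0// /normal_fun subr0 expr1n mulr2n.
Qed.

Lemma measurable_power_bell k : measurable_fun setT (fun x : R => x ^+ k * bell x).
Proof.
apply: measurable_funM; first exact: exprn_measurable.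
apply: measurableT_comp => //; apply: measurable_funM => //.
by apply: measurableT_comp => //; exact: exprn_measurable.
Qed.

(** One term of the series of [exp(x^2/4)] bounds [x^(2k)]. The rate 1/4 is half of that in [bell],
    so the product with [bell] still decays. *)
Lemma power_le_exp k (x : R) :
  `|x| ^+ k <= (1 + (4 ^ k * k`!)%:R) * expR (x ^+ 2 / 4).
Proof.
have y0 : 0 <= x ^+ 2 / 4 by rewrite divr_ge0 ?sqr_ge0.
have e1 : 1 <= expR (x ^+ 2 / 4) by rewrite (le_trans _ (expR_ge1Dx _))// lerDl.
have pk : (x ^+ 2) ^+ k <= (4 ^ k * k`!)%:R * expR (x ^+ 2 / 4).
  case: k => [|k]; first by rewrite expr0 expn0 fact0 mul1n mul1r.
  have := expR_ge1Dxn k y0; rewrite expr_div_n => h.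
  have f0 : 0 < (k.+1`!)%:R :> R by rewrite ltr0n fact_gt0.
  have p0 : 0 < 4 ^+ k.+1 :> R by rewrite exprn_gt0.
  rewrite natrM natrX -ler_pdivrMl ?mulr_gt0//.
  apply: le_trans h; rewrite [leLHS](_ : _ = (x ^+ 2) ^+ k.+1 / 4 ^+ k.+1 / (k.+1)`!%:R).
    by rewrite lerDr.
  by rewrite invfM mulrC mulrA.
have xk : `|x| ^+ k <= 1 + (x ^+ 2) ^+ k.
  rewrite -real_normK ?num_real// -exprM mulnC exprM.
  have : 0 <= `|x| ^+ k by rewrite exprn_ge0.
  set t := `|x| ^+ k; nra.
rewrite (le_trans xk)// mulrDl mul1r lerD//.
Qed.

Lemma integrable_power_bell k :
  leb.-integrable setT (fun x : R => (x ^+ k * bell x)%:E).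
Proof.
(* The density of variance 2 is a multiple of [exp(-x^2/4)] and serves as integrable majorant. *)
pose s : R := Num.sqrt 2.
have s2 : s ^+ 2 = 2 by rewrite sqr_sqrtr.
have s0 : s != 0 by rewrite gt_eqF// sqrtr_gt0.
have sE x : normal_pdf 0 s x = normal_peak s * expR (- x ^+ 2 / 4).
  by rewrite normal_pdfE// /normal_fun subr0 s2 -mulr_natr -natrM.
have ps : 0 < normal_peak s by rewrite normal_peak_gt0.
pose C : R := (1 + (4 ^ k * k`!)%:R) / normal_peak s.
have C0 : 0 <= C by rewrite divr_ge0 ?addr_ge0 ?ler0n ?ler01// ltW.
apply: (@le_integrable _ _ _ leb setT measurableT _
    (fun x => (C%:E * (normal_pdf 0 s x)%:E)%E)).
- by apply/measurable_EFinP; exact: measurable_power_bell.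
- move=> x _.
  have -> : (`|(x ^+ k * bell x)%:E| = (`|x| ^+ k * bell x)%:E)%E.
    by rewrite abse_EFin normrM normrX (ger0_norm (bell_ge0 x)).
  rewrite -EFinM abse_EFin lee_fin.
  rewrite [leRHS]ger0_norm; last by rewrite mulr_ge0// normal_pdf_ge0.
  rewrite sE /C mulrA divfK ?gt_eqF//.
  apply: (@le_trans _ _ ((1 + (4 ^ k * k`!)%:R) * expR (x ^+ 2 / 4) * bell x)).
    by rewrite ler_wpM2r ?bell_ge0// power_le_exp.
  rewrite -mulrA /bell -expRD le_eqVlt; apply/orP; left; apply/eqP.
  by congr (_ * expR _); field.
- by apply: integrableZl => //; exact: integrable_normal_pdf.
Qed.

(** The next power times [bell] is bounded, whence a bound of order 1/n. *)
Lemma cvg_power_bell k :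
  (fun n : nat => (n%:R : R) ^+ k * bell n%:R) @ \oo --> (0 : R).
Proof.
apply: (@squeeze_cvgr _ _ _ _ (cst 0) (fun n : nat =>
  (1 + (4 ^ k.+1 * k.+1`!)%:R) * (n%:R : R)^-1)).
- near=> n.
  have n0 : 0 < (n%:R : R) by rewrite ltr0n; near: n; exact: nbhs_infty_gt.
  rewrite mulr_ge0 ?bell_ge0 ?exprn_ge0 ?ler0n//=.
  rewrite ler_pdivlMr// mulrC mulrA -exprS.
  have := power_le_exp k.+1 (n%:R : R); rewrite ger0_norm ?ler0n// => h.
  apply: (le_trans (ler_wpM2r (bell_ge0 _) h)).
  rewrite -mulrA ler_piMr ?addr_ge0 ?ler0n// /bell -expRD -[leRHS]expR0 ler_expR.
  have := sqr_ge0 (n%:R : R); lra.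
- exact: cvg_cst.
- rewrite -[X in _ --> X](mulr0 (1 + (4 ^ k.+1 * k.+1`!)%:R)).
  apply: cvgMr; apply/gtr0_cvgV0; last exact: cvgr_idn.
  near=> n; rewrite ltr0n; near: n; exact: nbhs_infty_gt.
Unshelve. all: by end_near. Qed.

Lemma bell_opp x : bell (- x) = bell x. Proof. by rewrite /bell sqrrN. Qed.

Let F k (x : R) := x ^+ k * bell x.
Let f k (x : R) := k%:R * (x ^+ k.-1 * bell x) - x ^+ k.+1 * bell x.

Lemma is_derive_power_bell (k : nat) (x : R) : is_derive x (1 : R) (F k) (f k x).
Proof.
have dX : is_derive x 1 (fun y => y ^+ k) (k%:R * x ^+ k.-1).
  have := is_derive_poly ('X^k) x; rewrite derivXn hornerMn hornerXn -mulr_natl.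
  by rewrite (_ : horner 'X^k = fun y => y ^+ k)//; apply/funext => y; rewrite hornerXn.
have dbell : is_derive x 1 bell (- x * bell x).
  rewrite mulrC; apply: (@is_derive1_comp _ expR (fun y => - y ^+ 2 / 2)).
  have := is_derive_poly ((- 2^-1) *: 'X^2) x.
  rewrite derivZ derivXn hornerZ hornerMn hornerXn.
  have -> : horner (- 2^-1 *: 'X^2) = fun y : R => - y ^+ 2 / 2.
    by apply/funext => y; rewrite hornerZ hornerXn mulNr mulrC mulNr.
  by congr is_derive; rewrite /= expr1; field.
have -> : f k x = x ^+ k *: (- x * bell x) + bell x *: (k%:R * x ^+ k.-1).
  by rewrite /f /GRing.scale/= exprS; ring.
exact: (is_deriveM dX dbell).

Qed.

(** Fundamental theorem of calculus on growing symmetric intervals; the boundary terms tend to 0 and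
    dominated convergence gives the whole line. *)
Lemma integral_deriv_power_bell k : (\int[leb]_x (f k x)%:E)%E = 0%E.
Proof.
have cF : continuous (F k).
  by move=> x; apply/differentiable_continuous/derivable1_diffP; case: (is_derive_power_bell k x).
have intf : leb.-integrable setT (fun x : R => (f k x)%:E).
  rewrite (_ : (fun _ => _) = fun x : R => (k%:R%:E * (x ^+ k.-1 * bell x)%:E -
      (x ^+ k.+1 * bell x)%:E)%E); last by apply/funext => x; rewrite -EFinM -EFinB.
  by apply: integrableB => //; [apply: integrableZl => //|];
    exact: integrable_power_bell.
have mf : measurable_fun setT (fun x : R => (f k x)%:E) by exact: measurable_int intf.
have cbell : continuous bell.
  move=> x; have := is_derive_power_bell 0 x; rewrite /F.
  under [X in is_derive _ _ X]eq_fun do rewrite mul1r.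
  by case=> + _; move/derivable1_diffP/differentiable_continuous.
have cf : continuous (f k).
  move=> x; apply: cvgB; [apply: cvgMr|]; apply: cvgM; try exact: exprn_continuous; exact: cbell.
pose u (n : nat) (x : R) := ((fun x => (f k x)%:E) \_ `[- n.+1%:R, n.+1%:R]) x.
have uint n : (\int[leb]_x u n x)%E = (F k n.+1%:R - F k (- n.+1%:R))%:E.
  rewrite -integral_mkcond (@continuous_FTC2 _ _ (F k)).
  - by rewrite EFinB.
  - by rewrite gtrN// ltr0n.
  - by apply: continuous_subspaceT.
  - split.
    + by move=> x _; case: (is_derive_power_bell k x).
    + by apply: cvg_at_right_filter; exact: cF.
    + by apply: cvg_at_left_filter; exact: cF.
  - by move=> x _; rewrite derive1E; case: (is_derive_power_bell k x).
have h1 : (fun n => \int[leb]_x u n x)%E @ \oo --> (\int[leb]_x (f k x)%:E)%E.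
  apply: (@dominated_cvg _ _ _ leb setT measurableT u _ (fun x => `|(f k x)%:E|%E)) => //.
  - move=> n; rewrite -[u n]/((fun x => (f k x)%:E) \_ `[- n.+1%:R, n.+1%:R]).
    apply/measurable_restrict => //; rewrite setTI; exact: measurable_funTS.
  - move=> x _; apply: cvg_near_cst; near=> n.
    rewrite /u patchE mem_set//= in_itv/= -ler_norml.
    have xn : `|x| <= n%:R by near: n; exact: nbhs_infty_ger.
    by rewrite (le_trans xn)// ler_nat.
  - exact: integrable_abse.
  - move=> n x _; rewrite /u patchE; case: ifP => // _.
    by rewrite abse0 abse_ge0.
have h2 : (fun n => \int[leb]_x u n x)%E @ \oo --> 0%E.
  under eq_fun do rewrite uint.
  apply: cvg_EFin; first exact: nearW.
  (* [F k] is even or odd, so one limit handles both end points. *)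
  rewrite (_ : _ \o _ = fun n : nat => (1 - (-1) ^+ k) *
      ((n.+1%:R : R) ^+ k * bell n.+1%:R)); last first.
    apply/funext => n /=; rewrite /F bell_opp [in X in _ - X]exprNn; ring.
  rewrite -[X in _ --> X](mulr0 (1 - (-1) ^+ k)); apply: cvgMr.
  by have := cvg_power_bell k; rewrite -cvg_shiftS.
exact: (cvg_unique _ h1 h2).
Unshelve. all: by end_near. Qed.

Let g k (x : R) := x ^+ k * normal_pdf 0 1 x.

(** The vanishing integral of the derivative is the recursion of [gauss_moment], which starts from
    the total mass of the density. *)
Lemma integral_power_normal_pdf k :
  (\int[leb]_x (g k x)%:E)%E = (gauss_moment k)%:R%:E.
Proof.
pose mom j := fine (\int[leb]_x (F j x)%:E)%E.
have momE j : (\int[leb]_x (F j x)%:E)%E = (mom j)%:E.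
  have intF := integrable_power_bell j; rewrite fineK//; exact: integrable_fin_num.
have pdfE j : (\int[leb]_x (g j x)%:E)%E =
    (normal_peak 1 * mom j)%:E.
  under eq_integral do rewrite /g normal_pdf_bell mulrCA EFinM.
  by rewrite integralZl//; [rewrite momE|exact: integrable_power_bell].
have rec j : mom j.+1 = j%:R * mom j.-1.
  have := integral_deriv_power_bell j.
  under eq_integral do rewrite /f EFinB EFinM.
  rewrite integralB//; last 2 first.
  - by apply: integrableZl => //; exact: integrable_power_bell.
  - exact: integrable_power_bell.
  rewrite integralZl//; last exact: integrable_power_bell.
  by rewrite !momE -EFinM -EFinB => -[] /eqP; rewrite subr_eq0 => /eqP.
rewrite pdfE; congr EFin; elim/ltn_ind: k => -[|[|k]] IH.
- have := pdfE 0; under eq_integral do rewrite /g expr0 mul1r.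
  by rewrite integral_normal_pdf => -[].
- by rewrite rec mul0r mulr0.
- by rewrite rec/= mulrCA IH// natrM.
Qed.

End GaussMoments.

Section StandardGaussianMoments.
Context (d : measure_display) (T : measurableType d) (R : realType).
Variables (P : probability T R) (X : {RV P >-> R}).
Hypothesis gaussX : standard_gaussian X.

Let integral_RV (h : R -> R) : measurable_fun setT h ->
  (\int[P]_w (h (X w))%:E)%E =
  (\int[lebesgue_measure]_x (h x * normal_pdf 0 1 x)%:E)%E.
Proof.
move=> mh; pose nu : {measure set (measurableTypeR R) -> \bar R} := normal_prob (0 : R) (1 : R).
(* Both sides are carried to the law [nu]: from [P] with density 1 along [X], and from Lebesgue
   measure with density [normal_pdf] along the identity. *)
transitivity (\int[nu]_x (h x)%:E)%E.
  rewrite -(@integral_transfer _ _ _ _ _ P nu X (cst 1))//.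
  - by apply: eq_integral => w _; rewrite mulr1.
  - exact: (measurable_funP X).
  - move=> A mA; have mXA : measurable (X @^-1` A).
      by rewrite -[X in measurable X]setTI; exact: measurable_funP.
    have := integral_cst P mXA 1%E; rewrite mul1e => ->; exact: gaussX.
rewrite -(@integral_transfer _ _ _ _ _ lebesgue_measure nu id (normal_pdf 0 1))//.
- exact: measurable_normal_pdf.
- by move=> x; exact: normal_pdf_ge0.
Qed.

Lemma standard_gaussian_moment k :
  P.-integrable setT (fun w => (X w ^+ k)%:E) /\
  (\int[P]_w (X w ^+ k)%:E)%E = (gauss_moment k)%:R%:E.
Proof.
have mX h : measurable_fun setT h -> measurable_fun setT (fun w => (h (X w) : R)).
  by move=> mh; exact: measurableT_comp.
have mpow : measurable_fun setT (fun x : R => x ^+ k) by exact: exprn_measurable.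
split; last first.
  by rewrite (integral_RV mpow) integral_power_normal_pdf.
apply/integrableP; split; first by apply/measurable_EFinP; exact: (mX (fun x : R => x ^+ k)).
have mabs : measurable_fun setT (fun x : R => `|x ^+ k|) by exact: measurableT_comp.
rewrite -[X in (X < _)%E]/(\int[P]_w ((fun x : R => `|x ^+ k|) (X w))%:E)%E.
rewrite (integral_RV mabs).
have : lebesgue_measure.-integrable setT (fun x : R => (x ^+ k * normal_pdf 0 1 x)%:E).
  rewrite (_ : (fun _ => _) = fun x : R =>
      ((normal_peak 1)%:E * (x ^+ k * bell x)%:E)%E); last first.
    by apply/funext => x; rewrite normal_pdf_bell -EFinM mulrCA.
  by apply: integrableZl => //; exact: integrable_power_bell.
move=> /integrableP[_]; congr (_ < _)%E; apply: eq_integral => x _.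
by rewrite abse_EFin normrM (ger0_norm (normal_pdf_ge0 _ _ _)).
Qed.

End StandardGaussianMoments.

(** * The Gaussian expectation as a functional on polynomials *)

Section GaussFunctional.
Variable R : realType.

(** Defined through the moments, so that linearity and the Stein identity are purely algebraic. *)
Definition gauss_eval (q : {poly R}) : R :=
  \sum_(k < size q) q`_k * (gauss_moment k)%:R.

Lemma gauss_evalE n (q : {poly R}) : (size q <= n)%N ->
  gauss_eval q = \sum_(k < n) q`_k * (gauss_moment k)%:R.
Proof.
move=> qn; rewrite /gauss_eval (big_ord_widen n (fun k => q`_k * (gauss_moment k)%:R))//.
rewrite big_mkcond; apply: eq_bigr => k _; case: ltnP => // qk.
by rewrite nth_default// mul0r.
Qed.

Lemma gauss_eval_scalar : scalar gauss_eval.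
Proof.
move=> a q r; pose n := maxn (size q) (size r).
rewrite (@gauss_evalE n (a *: q + r)); last first.
  by rewrite (leq_trans (size_polyD _ _))// geq_max !leq_max leqnn size_scale_leq orbT.
rewrite (@gauss_evalE n q) ?leq_max ?leqnn//.
rewrite (@gauss_evalE n r) ?leq_max ?leqnn ?orbT//.
rewrite mulr_sumr -big_split; apply: eq_bigr => k _ /=.
by rewrite coefD coefZ mulrDl mulrA.
Qed.

HB.instance Definition _ :=
  GRing.isLinear.Build R {poly R} R *%R gauss_eval gauss_eval_scalar.

Lemma gauss_evalXn k : gauss_eval 'X^k = (gauss_moment k)%:R.
Proof.
rewrite (@gauss_evalE k.+1) ?size_polyXn// big_ord_recr/= coefXn eqxx mul1r.
rewrite big1 ?add0r// => i _; rewrite coefXn ltn_eqF// mul0r//.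
Qed.

(** Coefficientwise this is the recursion defining [gauss_moment]. *)
Lemma gauss_eval_stein (q : {poly R}) : gauss_eval ('X * q) = gauss_eval q^`().
Proof.
rewrite (@gauss_evalE (size q).+1); last first.
  by rewrite (leq_trans (size_polyMleq _ _))// size_polyX.
rewrite big_ord_recl/= coefXM mul0r add0r.
case sq : (size q) => [|n].
  move/eqP: sq; rewrite size_poly_eq0 => /eqP ->.
  by rewrite linear0 linear0 big_ord0.
have q0 : q != 0 by rewrite -size_poly_gt0 sq.
rewrite big_ord_recl (@gauss_evalE n); last by rewrite -ltnS -sq lt_size_deriv.
rewrite !coefXM/= mulr0 add0r; apply: eq_bigr => i _.
by rewrite coefXM/= coef_deriv /bump/= !add1n !add0n natrM mulr_natl mulrnAr mulrnAl.
Qed.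

Lemma gauss_eval_hermite n : gauss_eval (hermite R n) = (n == 0)%:R.
Proof.
by apply: stein_hermite; [rewrite /= -(expr0 'X) gauss_evalXn|exact: gauss_eval_stein].
Qed.

End GaussFunctional.

(** * The trace moments of the Gaussian matrix *)

Section Edges.
Variable n : nat.

(** Putting the larger index first represents unordered pairs by the index set of the independent
    entries. *)
Definition edge (i j : 'I_n) : 'I_n * 'I_n := if (j <= i)%N then (i, j) else (j, i).

Lemma edgeC i j : edge i j = edge j i.
Proof. by rewrite /edge; case: ltngtP => // /val_inj ->. Qed.

Lemma edge_inj i j k l : edge i j = edge k l -> (i = k /\ j = l) \/ (i = l /\ j = k).
Proof.
by rewrite /edge; case: ifP => _; case: ifP => _ [-> ->]; [left|right|right|left].
Qed.

Lemma edge_lower i j : ((edge i j).2 <= (edge i j).1)%N.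
Proof. by rewrite /edge; case: (leqP j i) => //= /ltnW. Qed.

End Edges.

Lemma prod_count (R : comPzRingType) (E : finType) (G : E -> R) (t : seq E) :
  \prod_(e <- t) G e = \prod_e G e ^+ count_mem e t.
Proof.
elim: t => [|a t IH]; first by rewrite big_nil big1.
rewrite big_cons IH (bigD1 a)//= [RHS](bigD1 a)//= eqxx add1n exprS mulrA.
by congr (_ * _); apply: eq_bigr => e /negPf; rewrite eq_sym => ->.
Qed.

Lemma walk_sum_ge0 (R : realFieldType) (I : finType) k (i j : I) (f : seq (I * I) -> R) :
  (forall s, 0 <= f s) -> 0 <= walk_sum k i j f.
Proof.
elim: k j f => [|k IH] j f f0 /=; first by rewrite mulr_ge0.
by rewrite sumr_ge0// => l _; apply: IH.
Qed.

Lemma integral_walk_sum d (T : measurableType d) (R : realType)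
    (P : {measure set T -> \bar R}) (I : finType) k (i j : I)
    (f : T -> seq (I * I) -> R) (h : seq (I * I) -> R) :
  (forall s, P.-integrable setT (fun w => (f w s)%:E) /\
             (\int[P]_w (f w s)%:E)%E = (h s)%:E) ->
  P.-integrable setT (fun w => (walk_sum k i j (f w))%:E) /\
  (\int[P]_w (walk_sum k i j (f w))%:E)%E = (walk_sum k i j h)%:E.
Proof.
elim: k j f h => [|k IH] j f h fh /=.
  under eq_fun do rewrite EFinM.
  by have [fi fE] := fh [::]; split; [exact: integrableZl|rewrite integralZl// fE].
have IHl l := IH l (fun w s => f w ((j, l) :: s)) (fun s => h ((j, l) :: s))
  (fun s => fh ((j, l) :: s)).
under eq_fun do rewrite -sumEFin.
split; first by apply: integrable_sum => // l _; exact: (IHl l).1.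
rewrite integral_sum//; last by move=> l; exact: (IHl l).1.
by rewrite -sumEFin; apply: eq_bigr => l _; exact: (IHl l).2.
Qed.

Section Moments.
Variables (R : realType) (d : measure_display) (T : measurableType d).
Variables (P : probability T R) (n : nat) (b : 'M[R]_n).
Variables (g : 'I_n -> 'I_n -> {RV P >-> R}) (X : T -> 'M[R]_n).
Hypothesis g_sym : forall (i j : 'I_n) (w : T), g i j w = g j i w.
Hypothesis g_gauss : forall i j : 'I_n, (j <= i)%N -> standard_gaussian (g i j).
Hypothesis g_indep : mutually_independent
       [set ij : 'I_n * 'I_n | (ij.2 <= ij.1)%N] (fun ij => g ij.1 ij.2).
Hypothesis X_def : forall (w : T) (i j : 'I_n), X w i j = b i j * g i j w.

Local Notation weight := (fun s => walk_weight (@edge n) (@gauss_eval R)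
  (fun i j => b i j) s (fun=> 0%N)).

Lemma g_gauss_all i j : standard_gaussian (g i j).
Proof.
have [ji|/ltnW ij] := leqP j i; first exact: g_gauss.
have gE : g i j = g j i :> (T -> R) by apply/funext => w; exact: g_sym.
by move=> A mA; rewrite -(g_gauss ij mA) /distribution /pushforward gE.
Qed.

(** Group the steps by edge: independence factors the expectation into moments whose orders are the
    multiplicities of the edges. *)
Lemma integral_walk_weight s :
  P.-integrable setT (fun w => (\prod_(x <- s) X w x.1 x.2)%:E) /\
  (\int[P]_w (\prod_(x <- s) X w x.1 x.2)%:E)%E = (weight s)%:E.
Proof.
pose t := [seq edge x.1 x.2 | x <- s].
pose l := [seq e : 'I_n * 'I_n <- enum {: 'I_n * 'I_n} | (e.2 <= e.1)%N].
pose f (e : 'I_n * 'I_n) (x : R) := x ^+ count_mem e t.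
have XE w : \prod_(x <- s) X w x.1 x.2 =
    \prod_(x <- s) b x.1 x.2 * \prod_(e <- l) f e (g e.1 e.2 w).
  under eq_bigr do rewrite X_def; rewrite big_split/=; congr (_ * _).
  rewrite (eq_bigr (fun x => g (edge x.1 x.2).1 (edge x.1 x.2).2 w)) => [|x _].
    rewrite -(big_map (fun x => edge x.1 x.2) predT (fun e => g e.1 e.2 w)) -/t.
    rewrite prod_count /l big_filter big_enum_cond/= [RHS]big_mkcond/=.
    apply: eq_bigr => e _; case: ifPn => // ne.
    rewrite (count_memPn _) ?expr0//; apply: contraNN ne => /mapP[x _ ->].
    exact: edge_lower.
  by rewrite /edge; case: ifP => //= _; exact: g_sym.
have ff e : P.-integrable setT (fun w => (f e (g e.1 e.2 w))%:E) /\
    (\int[P]_w (f e (g e.1 e.2 w))%:E)%E = (gauss_moment (count_mem e t))%:R%:E.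
  exact: standard_gaussian_moment (@g_gauss_all e.1 e.2) _.
have [||||fi fE] := indep_integral_prod g_indep (l := l) (f := f).
- by rewrite filter_uniq ?enum_uniq.
- by move=> e; rewrite mem_filter => /andP[].
- by move=> e; exact: exprn_measurable.
- by move=> e; exact: (ff e).1.
under eq_fun do rewrite XE EFinM.
split; first exact: integrableZl.
rewrite integralZl// fE -EFinM; congr (_ * _)%:E.
rewrite /l big_filter big_enum_cond/= big_mkcond/= /wick -/t.
apply: eq_bigr => e _; rewrite -[hermite R 0]/1 mulr1 [RHS]gauss_evalXn (ff e).2/=.
(* Pairs above the diagonal are never edges and contribute the moment of order 0, which is 1. *)
case: ifPn => // ne; rewrite (count_memPn _)//.
by apply: contraNN ne => /mapP[x _ ->]; exact: edge_lower.
Qed.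

Lemma expectation_trace k :
  'E_P[fun w => \tr (X w ^+ k)%R]%E = (\sum_i walk_sum k i i weight)%:E.
Proof.
rewrite unlock; have wk i := integral_walk_sum k i i integral_walk_weight.
under eq_integral => w _.
  rewrite /mxtrace; under eq_bigr do rewrite exprmx_walk_sum.
  rewrite -sumEFin; over.
rewrite integral_sum//; last by move=> i; exact: (wk i).1.
by rewrite -sumEFin; apply: eq_bigr => i _; exact: (wk i).2.
Qed.

End Moments.

(** * Passage from the walk bound to the stated inequality *)

Theorem theorem2p1 (R : realType) (d : measure_display) (T : measurableType d)
    (P : probability T R) (n : nat) (b : 'M[R]_n)
    (g : 'I_n -> 'I_n -> {RV P >-> R}) (X : T -> 'M[R]_n)
    (b_sym : forall i j : 'I_n, b i j = b j i)
    (b_ge0 : forall i j : 'I_n, 0 <= b i j)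
    (g_sym : forall (i j : 'I_n) (w : T), g i j w = g j i w)
    (g_gauss : forall i j : 'I_n, (j <= i)%N -> standard_gaussian (g i j))
    (g_indep : mutually_independent
       [set ij : 'I_n * 'I_n | (ij.2 <= ij.1)%N] (fun ij => g ij.1 ij.2))
    (X_def : forall (w : T) (i j : 'I_n), X w i j = b i j * g i j w)
    (p : nat) (p_gt0 : (0 < p)%N) :
  (('E_P[fun w => \tr (X w ^+ (2 * p))]) `^ ((2 * p)%:R^-1) <=
   (2 * (\sum_i (\sum_j b i j ^+ 2) ^+ p) `^ ((2 * p)%:R^-1)
    + 5 * Num.sqrt (2 * p)%:R
        * (\sum_i \big[Num.max/0]_j b i j ^+ (2 * p)) `^ ((2 * p)%:R^-1))%R%:E)%E.
Proof.
rewrite (expectation_trace g_sym g_gauss g_indep X_def) poweR_EFin lee_fin.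
set v := \sum_i walk_sum _ _ _ _.
set SA := \sum_i (\sum_j b i j ^+ 2) ^+ p.
set SB := \sum_i \big[Num.max/0]_j b i j ^+ (2 * p).
have p2 : (0 < 2 * p)%N by rewrite muln_gt0.
have p2R : ((2 * p)%:R : R) != 0 by rewrite pnatr_eq0 -lt0n.
have p2V : ((2 * p)%:R : R)^-1 != 0 by rewrite invr_eq0.
have p2V0 : 0 <= ((2 * p)%:R : R)^-1 by rewrite invr_ge0.
have rootX (x : R) : 0 <= x -> (x `^ (2 * p)%:R^-1) ^+ (2 * p) = x.
  by move=> x0; rewrite -powR_mulrn ?powR_ge0// -powRrM mulVf// powRr1.
have Xroot (x : R) : 0 <= x -> (x ^+ (2 * p)) `^ (2 * p)%:R^-1 = x.
  by move=> x0; rewrite -powR_mulrn// -powRrM mulfV// powRr1.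
have row0 i : 0 <= \sum_j b i j ^+ 2 by rewrite sumr_ge0// => j _; exact: sqr_ge0.
have max_le i j : b i j ^+ (2 * p) <= \big[Num.max/0]_j b i j ^+ (2 * p).
  exact: (le_bigmax 0 (fun j => b i j ^+ (2 * p)) j).
have max0 i : 0 <= \big[Num.max/0]_j b i j ^+ (2 * p).
  by rewrite bigmax_idl le_max lexx.
have SA0 : 0 <= SA by rewrite sumr_ge0// => i _; rewrite exprn_ge0.
have SB0 : 0 <= SB by rewrite sumr_ge0.
have v0 : 0 <= v.
  rewrite sumr_ge0// => i _; apply: walk_sum_ge0 => s; rewrite /walk_weight.
  apply: mulr_ge0; first by rewrite prodr_ge0.
  by apply: wick_ge0; exact: gauss_eval_hermite.
(* For [b = 0] both norms vanish, whereas the walk bound asks for positive [A] and [B]; this case is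
   settled directly. *)
have [b0|/existsNP[i0 /existsNP[j0 /eqP b_neq0]]] := pselect (forall i j, b i j = 0).
  have -> : v = 0.
    rewrite /v big1// => i _; rewrite -(prednK p2)/= big1// => l _.
    transitivity (walk_sum (2 * p).-1 i l (fun=> (0 : R) * 0)); last first.
      by rewrite walk_sumZ mul0r.
    by apply: eq_walk_sum => s; rewrite /walk_weight big_cons b0 !mul0r.
  by rewrite powR0// addr_ge0// !mulr_ge0// ?powR_ge0// sqrtr_ge0.
have bp0 : 0 < b i0 j0 by rewrite lt_def b_neq0 b_ge0.
have SAp : 0 < SA.
  rewrite /SA (bigD1 i0)//= ltr_wpDr ?sumr_ge0// => [i _|]; first by rewrite exprn_ge0.
  rewrite exprn_gt0// (bigD1 j0)//= ltr_wpDr ?exprn_gt0// sumr_ge0// => j _.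
  exact: sqr_ge0.
have SBp : 0 < SB.
  rewrite /SB (bigD1 i0)//= ltr_wpDr ?sumr_ge0//.
  by rewrite (lt_le_trans _ (max_le i0 j0))// exprn_gt0.
set A := SA `^ _; set B := SB `^ _.
have A0 : 0 < A by rewrite powR_gt0.
have B0 : 0 < B by rewrite powR_gt0.
(* The row maximum of [b], written as a root so that its power is the summand of [SB]. *)
pose s i := (\big[Num.max/0]_j b i j ^+ (2 * p)) `^ (2 * p)%:R^-1.
have vK : v <= (2 * A + 4 * B * Num.sqrt (2 * p)%:R) ^+ (2 * p).
  apply: (@closed_walk_Schatten_bound _ _ _ _ _ _
    (fun i => Num.sqrt (\sum_j b i j ^+ 2)) s) => //.
  - exact: gauss_eval_hermite.
  - exact: edgeC.
  - exact: edge_inj.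
  - by move=> i; rewrite sqr_sqrtr.
  - move=> i j; rewrite -(ler_pXn2r p2) ?nnegrE ?powR_ge0//.
    by rewrite /s rootX.
  - by move=> i; exact: powR_ge0.
  - rewrite rootX// ler_sum// => i _; rewrite exprM sqr_sqrtr//.
  - rewrite rootX// ler_sum// => i _; rewrite /s rootX//.
have K0 : 0 <= 2 * A + 4 * B * Num.sqrt (2 * p)%:R.
  by rewrite addr_ge0// !mulr_ge0// ?sqrtr_ge0// ltW.
apply: (le_trans (ge0_ler_powR p2V0 v0 _ vK)); first by rewrite nnegrE exprn_ge0.
(* The walk bound has the constant 4, which is relaxed to 5. *)
rewrite Xroot// lerD2l mulrAC ler_pM2r// ler_wpM2r ?sqrtr_ge0//.
by rewrite ler_nat.
Qed.
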